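(* Let $d\ge3$ and let $p_c,p_u$ be the critical probability and uniqueness threshold of $T_d\Box\mathbb{Z}$. For all $p\in(p_c,p_u)$, $$\alpha(p)\ge\frac{1}{d-1}.$$
   Context: $T_d$ is the $d$-regular tree with a fixed root (origin), and $T_d\Box\mathbb{Z}$ is its Cartesian product with the line $\mathbb{Z}$; vertices are pairs $(x,k)$ with $x\in T_d$, $k\in\mathbb{Z}$, and $o=(\text{root},0)$. In Bernoulli bond percolation with parameter $p\in[0,1]$ each edge is independently open with probability $p$ and closed otherwise; $\mathbb{P}_p$ is the associated probability measure. Clusters are the connected components of the subgraph of open edges. $p_c=\inf\{p\in[0,1]: \text{there exists an infinite cluster almost surely}\}$ and $p_u=\inf\{p\in[0,1]: \text{there exists a unique infinite cluster almost surely}\}$. For vertices $x,y$, $(x\leftrightarrow y)$ is the event that there is an open path between $x$ and $y$. Define $$\alpha(p)=\lim_{n\to\infty}\mathbb{P}_p(o\leftrightarrow(v_n,0))^{1/n}=\sup_{n\ge1}\mathbb{P}_p(o\leftrightarrow(v_n,0))^{1/n},$$ where $v_n$ is any vertex of $T_d$ at distance $n$ from the root (the value does not depend on the choice; the limit exists and equals the supremum by supermultiplicativity). *)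

(* Defs.v *)
From HB Require Import structures.
From mathcomp Require Import all_boot all_order all_algebra.
From mathcomp Require Import all_classical all_reals all_analysis.
Set Implicit Arguments.
Unset Strict Implicit.
Unset Printing Implicit Defensive.
Import Order.TTheory GRing.Theory Num.Theory.
Import numFieldNormedType.Exports.
Local Open Scope classical_set_scope.
Local Open Scope ring_scope.

(* [n] is the graph distance between [x] and [y]; the length of the walk
   [x :: s] is [size s]. *)
Definition at_distance (V : eqType) (adj : rel V) (x y : V) (n : nat) : Prop :=
  (exists s : seq V, [/\ path adj x s, last x s = y & size s = n]) /\
  (forall s : seq V, path adj x s -> last x s = y -> (n <= size s)%N).

Definition box_adj (V W : eqType) (adjV : rel V) (adjW : rel W) : rel (V * W) :=
  fun u v => (adjV u.1 v.1 && (u.2 == v.2)) || ((u.1 == v.1) && adjW u.2 v.2).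

Definition line_adj : rel int := fun k l => `|k - l| == 1.

(* [T_d] is realised as the Cayley graph of the free product of [d] copies of
   Z/2: vertices are the words over ['I_d] without two equal consecutive letters,
   and [i :: s] is a child of [s].  The lemmas [tree_adj_connected],
   [tree_adj_acyclic] and [tree_adj_regular] below check that this is a
   d-regular tree. *)
Definition reduced (d : nat) : pred (seq 'I_d) := sorted (fun i j => i != j).

Definition tree (d : nat) : Type := {s : seq 'I_d | reduced s}.
HB.instance Definition _ (d : nat) := Countable.on (tree d).

Definition tree_root (d : nat) : tree d := exist _ [::] isT.

Definition tree_child (d : nat) : rel (tree d) :=
  fun x y => (val y != [::]) && (behead (val y) == val x).

Definition tree_adj (d : nat) : rel (tree d) :=
  fun x y => tree_child x y || tree_child y x.

(* [TZ d] is the product of T_d and Z; [TZ_origin d] is o. *)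
Definition TZ (d : nat) : countType := (tree d * int)%type.

Definition TZ_adj (d : nat) : rel (TZ d) := box_adj (@tree_adj d) line_adj.

Definition TZ_origin (d : nat) : TZ d := (tree_root d, 0).

Section Configurations.
Variables (V : countType) (adj : rel V).

(* Each undirected edge {x, y} is represented exactly once, by the pair (x, y)
   such that [x] comes before [y] in the enumeration [pickle] of [V]. *)
Definition edge : Type :=
  {xy : V * V | adj xy.1 xy.2 && (pickle xy.1 < pickle xy.2)%N}.
HB.instance Definition _ := Countable.on edge.

(* [a e = true] means that the edge [e] is open in [a]. *)
Definition cylinder (F : seq edge) (a : edge -> bool) : set (edge -> bool) :=
  [set w | forall e, e \in F -> w e = a e].

(* {0,1}^E with the product sigma-algebra *)
Definition config : measurableType _ :=
  g_sigma_algebraType [set A | exists F a, A = cylinder F a].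

Definition open_adj (w : config) (x y : V) : Prop :=
  exists e : edge, w e /\ (val e = (x, y) \/ val e = (y, x)).

Definition joined (w : config) (x y : V) : Prop :=
  exists s : seq V, path (fun u v => `[< open_adj w u v >]) x s /\ last x s = y.

Definition cluster (w : config) (x : V) : set V := [set y | joined w x y].

Definition infinite_cluster (w : config) (C : set V) : Prop :=
  (exists x, C = cluster w x) /\ infinite_set C.

Variable R : realType.

(* Under [P] the states of the edges are independent Bernoulli(p) variables;
   this determines the probability measure [P]. *)
Definition is_bernoulli_percolation (p : R) (P : probability config R) : Prop :=
  forall (F : seq edge) (a : edge -> bool), uniq F ->
    P (cylinder F a) = (\prod_(e <- F) bernoulli_pmf p (a e))%:E.

(* In what follows [P p] plays the role of P_p; only its values at
   p in [0, 1] are relevant. *)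
Variable P : R -> probability config R.

Definition percolation_family : Prop :=
  forall p, 0 <= p <= 1 -> is_bernoulli_percolation p (P p).

Definition p_c : R := inf [set p | 0 <= p <= 1 /\
  {ae P p, forall w, exists C, infinite_cluster w C}].

Definition p_u : R := inf [set p | 0 <= p <= 1 /\
  {ae P p, forall w, exists! C, infinite_cluster w C}].

Definition connection_prob (p : R) (x y : V) : R :=
  fine (P p [set w | joined w x y]).

End Configurations.

(* The index n = 0, for which the exponent is 0^-1 = 0, does not affect the limit. *)
Definition alpha (d : nat) (R : realType)
    (P : R -> probability (config (@TZ_adj d)) R)
    (v : nat -> tree d) (p : R) : R :=
  limn (fun n : nat =>
    connection_prob P p (TZ_origin d) (v n, 0) `^ (n%:R)^-1).

Lemma tree_adj_sym (d : nat) : symmetric (@tree_adj d).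
Proof. by move=> x y; rewrite /tree_adj orbC. Qed.

Lemma tree_childP (d : nat) (x y : tree d) :
  reflect (exists i, val y = i :: val x) (tree_child x y).
Proof.
rewrite /tree_child; apply: (iffP andP) => [[]|[i ->]]; last by rewrite /= eqxx.
by case: (val y) => // i s _ /= /eqP <-; exists i.
Qed.

Lemma tree_path_root (d : nat) (x : tree d) :
  exists s : seq (tree d),
    [/\ path (@tree_adj d) (tree_root d) s, last (tree_root d) s = x
      & size s = size (val x)].
Proof.
case: x => s; elim: s => [|i s IHs] sP.
  by exists [::]; split => //; apply: val_inj.
have sP' : reduced s by move: sP; rewrite /reduced /= => /path_sorted.
have [t [tp tl ts]] := IHs sP'.
exists (rcons t (exist _ (i :: s) sP)); split.
- rewrite rcons_path tp tl /=; apply/orP; left; apply/tree_childP; by exists i.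
- by rewrite last_rcons.
- by rewrite size_rcons ts.
Qed.

Lemma tree_adj_connected (d : nat) (x y : tree d) :
  exists s : seq (tree d), path (@tree_adj d) x s /\ last x s = y.
Proof.
have [s [sp sl _]] := tree_path_root x; have [t [tp tl _]] := tree_path_root y.
exists (rev (belast (tree_root d) s) ++ t); split.
  rewrite cat_path -{1}sl.
  rewrite (eq_path (e' := fun u v => tree_adj v u)); last by move=> u v; rewrite tree_adj_sym.
  rewrite rev_path sp /=.
  suff -> : last x (rev (belast (tree_root d) s)) = tree_root d by [].
  by rewrite -sl; case: (s) => //= a s'; rewrite rev_cons last_rcons.
rewrite last_cat.
suff -> : last x (rev (belast (tree_root d) s)) = tree_root d by [].
by rewrite -sl; case: (s) => //= a s'; rewrite rev_cons last_rcons.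
Qed.

Lemma tree_adj_acyclic (d : nat) (c : seq (tree d)) :
  (2 < size c)%N -> ~ ucycle (@tree_adj d) c.
Proof.
move=> c2 /andP[cc cu].
(* the two neighbours in [c] of a longest word of [c] are both its parent *)
have [x xc xmax] : exists2 x, x \in c &
    forall y, y \in c -> (size (val y) <= size (val x))%N.
  have : c != [::] by case: (c) c2.
  elim: (c) => // a [|b c'] IHc _.
    by exists a; rewrite ?mem_head // => y; rewrite inE => /eqP ->.
  have [//|z zc zm] := IHc.
  have [le|lt] := leqP (size (val a)) (size (val z)).
    by exists z => [|y]; rewrite inE ?zc ?orbT // => /predU1P[->|/zm].
  exists a => [|y]; first exact: mem_head.
  by rewrite inE => /predU1P[->|/zm /leq_trans->] //; exact: ltnW.
have parent y : y \in c -> tree_adj x y -> val y = behead (val x).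
  move=> yc /orP[/tree_childP[i iE]|/andP[_ /eqP->//]].
  by have := xmax y yc; rewrite iE /= ltnn.
have nx : val (next c x) = behead (val x).
  by apply: parent; rewrite ?mem_next ?next_cycle.
have px : val (prev c x) = behead (val x).
  by apply: parent; rewrite ?mem_prev // tree_adj_sym prev_cycle.
have np : next c (next c x) = x.
  have -> : next c x = prev c x by apply: val_inj; rewrite nx px.
  exact: next_prev.
have [i c' cE] := rot_to xc.
have := cu; rewrite -(rot_uniq i); move: c2 np.
rewrite -!(next_rot i cu) -(size_rot i) cE.
case: c' {cE} => [//|a [//|b c']] _ /=; rewrite eqxx.
case: (eqVneq a x) => [->|_]; first by rewrite mem_head.
by rewrite eqxx => -> /andP[]; rewrite !inE eqxx orbT.
Qed.

Lemma tree_adj_regular (d : nat) (x : tree d) :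
  exists s : seq (tree d),
    [/\ uniq s, size s = d & forall y, (y \in s) = tree_adj x y].
Proof.
pose step (i : 'I_d) : seq 'I_d :=
  if val x is j :: s then if i == j then s else i :: j :: s else [:: i].
have stepP i : reduced (step i).
  rewrite /step; have := valP x; case: (val x) => [|j s] //= sP; case: eqVneq => [_|ij].
    exact: path_sorted sP.
  by rewrite /reduced /= ij.
pose f i : tree d := exist _ (step i) (stepP i).
have finj : injective f.
  move=> i j /(congr1 val); rewrite /= /step.
  case: (val x) => [[->]//|k s].
  case: (eqVneq i k) => [->|ik]; case: (eqVneq j k) => [->|jk] //.
  - by move=> /(congr1 size)/= E; have := leqnSn (size s).+1; rewrite -E ltnn.
  - by move=> /(congr1 size)/= E; have := leqnSn (size s).+1; rewrite E ltnn.
  - by case.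
exists [seq f i | i <- enum 'I_d]; split.
- by rewrite map_inj_uniq ?enum_uniq.
- by rewrite size_map size_enum_ord.
move=> y; apply/mapP/idP => [[i _ ->]|].
  have fE : val (f i) = step i by [].
  rewrite /tree_adj /tree_child fE /step; case: (val x) => [|j s] //.
  by case: (eqVneq i j) => _; rewrite /= !eqxx ?orbT.
move=> /orP[] /tree_childP[i iE].
  exists i; rewrite ?mem_enum //; apply: val_inj; rewrite /= iE /step.
  case: (val x) iE => [//|j s] iE; case: (eqVneq i j) => // ij.
  by have := valP y; rewrite /reduced iE /= ij eqxx.
exists i; rewrite ?mem_enum //; apply: val_inj.
by rewrite /= /step iE eqxx.
Qed.

Lemma tree_root_distance (d : nat) (x : tree d) (n : nat) :
  at_distance (@tree_adj d) (tree_root d) x n <-> size (val x) = n.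
Proof.
have lb (s : seq (tree d)) y : path (@tree_adj d) y s ->
    (size (val (last y s)) <= size (val y) + size s)%N.
  elim: s y => [|a s IHs] y /=; first by rewrite addn0.
  move=> /andP[ya /IHs/leq_trans-> //]; rewrite addnS -addSn leq_add2r.
  case/orP: ya => /tree_childP[i ->] //=.
  by rewrite -addn2 leq_addr.
have [s [sp sl ss]] := tree_path_root x.
split=> [[[t [tp tl <-]] tmin]|<-].
  apply/eqP; rewrite eqn_leq -{2}ss tmin // andbT.
  by have := lb _ _ tp; rewrite tl.
split; first by exists s.
by move=> t tp tl; have := lb _ _ tp; rewrite tl.
Qed.

(* Main.v *)
Require Import Defs.
From mathcomp Require Import finmap.
From HB Require Import structures.
From mathcomp Require Import all_boot all_order all_algebra.
From mathcomp Require Import all_classical all_reals all_analysis.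
From mathcomp Require Import perm measurable_realfun.
From mathcomp Require Import ring lra zify.
Set Implicit Arguments.
Unset Strict Implicit.
Unset Printing Implicit Defensive.
Import Order.TTheory GRing.Theory Num.Theory.
Import numFieldNormedType.Exports.
Local Open Scope classical_set_scope.
Local Open Scope ring_scope.

(** The reason is that for [p > p_c] the intersection of an infinite cluster with a
layer T_d x {k} cannot be too thin. Write tau_n for the probability that the origin
is joined to a vertex of height 0 at tree distance n, and a = alpha(p).

Harris' inequality and the symmetries of the graph make tau supermultiplicative, so
tau_n <= a ^ n for all n, by Fekete's lemma ([supermultiplicative_le_lim]). This
extends to all heights: if two vertices at distance n from x, in opposite directions,
are each joined to (x, k), then they are joined to each other, so the square of
the probability that the origin is joined to (x, k) is at most tau_(2n) <= a ^ (2n)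
([conn_sqr_le]). The sphere of radius n in T_d has at most d (d - 1) ^ (n - 1)
points; hence, if a < 1 / (d - 1), the expected number of points of the cluster of the
origin in a layer is bounded by one constant M for all layers ([sum_layer_le]).

Take now q < p such that there is almost surely an infinite cluster at q. Connection
probabilities increase with the parameter, so the bound M is still valid at q, and
q < 1. By Markov's inequality each layer contains almost surely finitely many points of
the cluster, so an infinite cluster must reach all heights, upwards or downwards. But
at each height it has a chance to be stopped: explore the cluster up to
layer k; outside an event of small probability it has at most n points in the layer,
where n does not depend on k, and then, independently of what has been explored, the
vertical edges above these points are all closed with probability at least (1 - q) ^ n
([hits_drop]). So the probability of reaching height k cannot stay away from 0
([hits_all_null]), there is almost surely no infinite cluster at q, and this is a
contradiction.

Two tools are used for the measure on configurations. It is determined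
by its values on cylinders, which gives its invariance under automorphisms
([prob_relabel]) and the independence used in the exploration ([prob_close]). And
increasing events that depend on finitely many open edges are limits of events on
finite sets of edges, where probabilities are computed by integrating out one
edge after the other ([expect]); Harris' inequality ([prob_harris]) and monotonicity in
the parameter ([prob_le_param]) are proved there. *)

(** * Events and the law of the configuration *)

Section Events.
Variables (V : countType) (adj : rel V).
Local Notation cfg := (config adj).
Implicit Types (w : cfg) (e : edge adj) (F : seq (edge adj)) (A B : set cfg).

Lemma measurable_ext A B : (forall w, A w <-> B w) -> measurable A -> measurable B.
Proof. by move=> AB; rewrite (_ : A = B) //; apply/seteqP; split=> w /AB. Qed.

Lemma measurable_cylinder F (a : edge adj -> bool) :
  measurable (cylinder F a : set cfg).
Proof. by apply: sub_sigma_algebra; exists F, a. Qed.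

Lemma measurable_state e (b : bool) : measurable [set w : cfg | w e = b].
Proof.
apply: (measurable_ext _ (measurable_cylinder [:: e] (fun=> b))) => w.
by split=> [|we e' /=]; [apply; rewrite inE|rewrite inE => /eqP->].
Qed.

Lemma measurable_const (Q : Prop) : measurable [set w : cfg | Q].
Proof.
have [q|nq] := pselect Q.
  by apply: (measurable_ext _ (@measurableT _ cfg)).
by apply: (measurable_ext _ (@measurable0 _ cfg)).
Qed.

Lemma measurable_exists (I : countType) (B : I -> set cfg) :
  (forall i, measurable (B i)) -> measurable [set w | exists i, B i w].
Proof.
move=> mB; have mU := countable_bigcupT_measurable (countableP [set: I]) mB.
by apply: (measurable_ext _ mU) => w; split=> /= [[i]|[i]]; [exists i|exists i].
Qed.

Lemma measurable_forall (I : countType) (B : I -> set cfg) :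
  (forall i, measurable (B i)) -> measurable [set w | forall i, B i w].
Proof.
move=> mB.
have mC : measurable [set w | exists i, ~ B i w].
  by apply: measurable_exists => i; exact: measurableC.
apply: (measurable_ext _ (measurableC mC)) => w /=; split=> [/forallNP nB i|Bw [i []//]].
exact: contrapT.
Qed.

Lemma measurable_conj A B : measurable A -> measurable B ->
  measurable [set w | A w /\ B w].
Proof. exact: measurableI. Qed.

Lemma measurable_imply (Q : Prop) B :
  (Q -> measurable B) -> measurable [set w | Q -> B w].
Proof.
have [q|nq] := pselect Q => mB.
  by apply: (measurable_ext _ (mB q)) => w; split=> //=; apply.
by apply: (measurable_ext _ (@measurableT _ cfg)) => w; split=> // _ /nq.
Qed.

Lemma measurable_config_map (T : cfg -> cfg) :
  (forall e, measurable [set w | T w e]) -> measurable_fun setT T.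
Proof.
move=> mT.
apply: (@measurability _ _ cfg cfg setT T [set A | exists F a, A = cylinder F a]) => //.
move=> _ [_ [F [a ->]] <-]; rewrite setTI.
apply: measurable_forall => e; apply: measurable_imply => _ /=.
case: (a e); first exact: mT.
by apply: (measurable_ext _ (measurableC (mT e))) => w /=; split=> [/negP/negbTE|->].
Qed.

Definition set_state w e (b : bool) : cfg := fun e' => if e' == e then b else w e'.

Lemma set_state_same w e b : set_state w e b e = b.
Proof. by rewrite /set_state eqxx. Qed.

Lemma measurable_set_state e b : measurable_fun setT (fun w => set_state w e b).
Proof.
apply: measurable_config_map => e'; rewrite /set_state.
case: eqVneq => _; [exact: measurable_const | exact: measurable_state].
Qed.

Lemma setI_cylinder F a F' a' :
  cylinder F a `&` cylinder F' a' = set0 \/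
  exists F2 a2, cylinder F a `&` cylinder F' a' = cylinder F2 a2.
Proof.
have [agree|] := pselect (forall e, e \in F -> e \in F' -> a e = a' e); last first.
  move=> dis; left; apply/seteqP; split=> // w [wF wF']; apply: dis => e eF eF'.
  by rewrite -(wF _ eF) (wF' _ eF').
right; exists (F ++ F'), (fun e => if e \in F then a e else a' e).
apply/seteqP; split=> w /=.
  move=> [wF wF'] e; rewrite mem_cat; case: ifP => [eF _|_ /=]; [exact: wF|exact: wF'].
move=> wFF; split=> e eF; rewrite wFF ?mem_cat ?eF ?orbT //.
by case: ifP => // eF2; exact: agree.
Qed.

(** Cylinders are not quite stable under intersection, because two of them may be
incompatible; adding the empty set makes them a pi-system. *)
Lemma eq_measure_cylinder (R : realType) (m1 m2 : {measure set cfg -> \bar R}) :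
  (m1 setT < +oo)%E ->
  (forall F a, uniq F -> m1 (cylinder F a) = m2 (cylinder F a)) ->
  forall A, measurable A -> m1 A = m2 A.
Proof.
move=> m1oo m12; pose G : set (set cfg) :=
  [set A | A = set0 \/ exists F a, A = cylinder F a].
have cT : cylinder [::] (fun=> true) = setT :> set cfg.
  by apply/seteqP; split=> w //= _ e.
apply: (measure_unique G (fun=> setT)).
- apply/seteqP; split.
    by apply: sub_smallest2r => // A [F [a ->]]; right; exists F, a.
  apply: smallest_sub; first exact: smallest_sigma_algebra.
  move=> A [->|[F [a ->]]]; first exact: (@measurable0 _ cfg).
  by apply: sub_sigma_algebra; exists F, a.
- move=> A B [->|[F [a ->]]]; first by rewrite set0I => _; left.
  by case=> [->|[F' [a' ->]]]; [rewrite setI0; left|exact: setI_cylinder].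
- by move=> _; right; exists [::], (fun=> true); rewrite cT.
- by rewrite bigcup_const //; exists 0%N.
- move=> _ [->|[F [a ->]]]; first by rewrite !measure0.
  rewrite (_ : cylinder F a = cylinder (undup F) a) ?m12 ?undup_uniq //.
  by apply/seteqP; split=> w wF e eF; apply: wF; rewrite ?mem_undup // -mem_undup.
- by [].
Qed.

End Events.

Arguments measurable_state {V adj} e b.
Arguments measurable_const {V adj} Q.

Section Bernoulli.
Variables (V : countType) (adj : rel V).
Local Notation cfg := (config adj).
Variables (R : realType) (p : R) (P : probability cfg R).
Hypothesis (p01 : 0 <= p <= 1) (hP : is_bernoulli_percolation p P).
Implicit Types (w : cfg) (e : edge adj) (F : seq (edge adj)) (A B : set cfg).

(** As [A] does not look at [e], it is its own preimage under the operation of closing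
[e]. So it is enough to prove the formula for all preimages under this operation; both
sides are then measures, and on cylinders the formula is the factorisation
of [is_bernoulli_percolation]. *)
Lemma prob_close1 e A : measurable A ->
  (forall w (b : bool), A w -> A (set_state w e b)) ->
  P (A `&` [set w | w e = false]) = ((1 - p)%:E * P A)%E.
Proof.
move=> mA inv.
have mT := measurable_set_state (adj := adj) e false.
set T := (fun w => set_state w e false) in mT.
have mD : measurable [set w : cfg | w e = false] by exact: measurable_state.
have q0 : 0 <= 1 - p by rewrite subr_ge0; case/andP: p01.
have TA : T @^-1` A = A.
  apply/seteqP; split=> w /=; last exact: inv.
  by move=> /(inv _ (w e)); rewrite (_ : set_state _ _ _ = w) //;
     apply/funext => e'; rewrite /T /set_state; case: eqP => // ->.
suff: forall B, measurable B -> mrestr P mD (T @^-1` B) = ((1 - p)%:E * P (T @^-1` B))%E.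
  by move=> /(_ _ mA); rewrite TA.
move=> B mB.
pose m1 : {measure set cfg -> \bar R} := pushforward (mrestr P mD) T.
pose m2 : {measure set cfg -> \bar R} := mscale (NngNum q0) (pushforward P T).
suff: m1 mT B = m2 mT B by [].
apply: eq_measure_cylinder => //.
  rewrite (_ : m1 mT setT = P [set w | w e = false]); last first.
    by congr (P _); apply/seteqP; split=> w //= [].
  by rewrite (le_lt_trans (probability_le1 _ _)) ?ltry.
move=> F a uF.
suff : P (T @^-1` cylinder F a `&` [set w | w e = false]) =
    ((1 - p)%:E * P (T @^-1` cylinder F a))%E by [].
have [eF|eF] := boolP (e \in F); last first.
  have -> : T @^-1` cylinder F a = cylinder F a.
    by apply/seteqP; split=> w wF e' e'F; have := wF _ e'F;
       rewrite /T /set_state; case: eqP e'F eF => // -> ->.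
  have -> : cylinder F a `&` [set w | w e = false] = cylinder (e :: F) (set_state a e false).
    apply/seteqP; split=> w.
      move=> [wF we] e'; rewrite inE /set_state; case: eqP => [->//|_ /=]; exact: wF.
    move=> wF; split=> [e' e'F|]; last by rewrite /= wF ?mem_head // set_state_same.
    rewrite wF ?inE ?e'F ?orbT // /set_state.
    by case: eqP e'F eF => // -> ->.
  rewrite !hP //= ?eF // big_cons set_state_same /= EFinM; congr (_ * _%:E)%E.
  by apply: eq_big_seq => e' e'F; rewrite /set_state; case: eqP e'F eF => // -> ->.
case ae: (a e).
  have -> : T @^-1` cylinder F a = set0.
    apply/seteqP; split=> // w /(_ _ eF); rewrite /T set_state_same ae //.
  by rewrite set0I !measure0 mule0.
have -> : T @^-1` cylinder F a = cylinder (rem e F) a.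
  apply/seteqP; split=> w wF e' e'F; have := e'F; rewrite ?(mem_rem_uniq _ uF) ?inE.
    move=> /andP[ne e'F']; have := wF _ e'F'.
    by rewrite /T /set_state (negbTE ne).
  rewrite /T /set_state; case: eqP => [->//|/eqP ne _].
  by apply: wF; rewrite mem_rem_uniq // inE ne.
have -> : cylinder (rem e F) a `&` [set w | w e = false] = cylinder F a.
  apply/seteqP; split=> w => [[wF we] e' e'F|wF].
    have [->|ne] := eqVneq e' e; first by rewrite ae.
    by apply: wF; rewrite mem_rem_uniq // inE ne.
  split=> [e' e'F|]; last by rewrite /= wF.
  by apply: wF; exact: mem_rem e'F.
rewrite !hP ?rem_uniq // -EFinM; congr EFin.
by rewrite (perm_big _ (perm_to_rem eF)) big_cons ae.
Qed.

Lemma prob_close (s : seq (edge adj)) A : uniq s -> measurable A ->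
  (forall w e (b : bool), e \in s -> A w -> A (set_state w e b)) ->
  P (A `&` [set w | forall e, e \in s -> w e = false])
    = (((1 - p) ^+ size s)%:E * P A)%E.
Proof.
move=> + mA; elim: s => [_ _|e s IHs /= /andP[es us] inv].
  rewrite expr0 mul1e; congr (P _).
  by apply/seteqP; split=> w; [case|split].
have -> : A `&` [set w | forall e', e' \in e :: s -> w e' = false] =
   (A `&` [set w | forall e', e' \in s -> w e' = false]) `&` [set w | w e = false].
  apply/seteqP; split=> w /= => [[Aw ws]|[[Aw ws] we]].
    by split; [split=> // e' e's|]; apply: ws; rewrite inE ?e's ?eqxx ?orbT.
  by split=> // e'; rewrite inE => /predU1P[->//|/ws].
rewrite prob_close1.
- rewrite IHs // => [|w e' b e's]; first by rewrite exprS EFinM muleA.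
  by apply: inv; rewrite inE e's orbT.
- apply: measurableI => //; apply: measurable_forall => e'.
  by apply: measurable_imply => _; exact: measurable_state.
- move=> w b [Aw ws]; split=> [|e' e's]; first by apply: inv => //; rewrite mem_head.
  rewrite /set_state; case: eqP e's es => [-> ->//|_ e's _]; exact: ws.
Qed.

End Bernoulli.

(** * Integration over finitely many edges *)

Section FiniteExpectation.
Variables (V : countType) (adj : rel V).
Local Notation cfg := (config adj).
Variable (R : realType).
Implicit Types (w : cfg) (e : edge adj) (F : seq (edge adj)) (A B : set cfg).
Implicit Types (f g : cfg -> R) (p : R).

Definition config_le w w' := forall e, w e -> w' e.

Definition monotone_fun f := forall w w', config_le w w' -> f w <= f w'.

Definition increasing_event A := forall w w', config_le w w' -> A w -> A w'.

Definition depends_on F A := forall w w', {in F, w =1 w'} -> A w -> A w'.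

(** The mean of [f] when the edges of [F] are resampled independently and the other
edges keep their state in [w]; the recursion on [F] lets all inequalities below be
reduced to one edge. *)
Fixpoint expect p F f w : R :=
  if F is e :: F' then
    p * expect p F' f (set_state w e true)
      + (1 - p) * expect p F' f (set_state w e false)
  else f w.

Lemma config_le_set_state w w' e b b' :
  config_le w w' -> b ==> b' -> config_le (set_state w e b) (set_state w' e b').
Proof.
by move=> ww' /implyP bb' e'; rewrite /set_state; case: eqP => [_ /bb'|_ /ww'].
Qed.

Lemma monotone_expect p F f : 0 <= p <= 1 -> monotone_fun f ->
  monotone_fun (expect p F f).
Proof.
move=> /andP[p0 p1] fi; elim: F => [|e F IHF] w w' ww' /=; first exact: fi.
by rewrite lerD // ler_wpM2l ?subr_ge0 //; apply: IHF; exact: config_le_set_state.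
Qed.

(** On one edge, raising the parameter moves mass from the smaller value to the larger. *)
Lemma expect_le_param p p' F f w : 0 <= p -> p <= p' -> p' <= 1 ->
  monotone_fun f -> expect p F f w <= expect p' F f w.
Proof.
move=> p0 pp' p'1 fi; elim: F w => [|e F IHF] w //=.
have := IHF (set_state w e true); have := IHF (set_state w e false).
have : expect p F f (set_state w e false) <= expect p F f (set_state w e true).
  by apply: monotone_expect => //; [lra | exact: config_le_set_state].
nra.
Qed.

(** One edge at a time: on a single edge the covariance of [f] and [g] is
[p (1 - p)] times the product of their increments, which is nonnegative. *)
Lemma expect_harris p F f g w : 0 <= p <= 1 ->
  monotone_fun f -> monotone_fun g ->
  (forall w, 0 <= f w) -> (forall w, 0 <= g w) ->
  expect p F f w * expect p F g w <= expect p F (fun w => f w * g w) w.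
Proof.
move=> p01 fi gi f0 g0; elim: F w => [|e F IHF] w //=.
have := IHF (set_state w e true); have := IHF (set_state w e false).
have le01 : config_le (set_state w e false) (set_state w e true).
  exact: config_le_set_state.
have fm := monotone_expect F p01 fi le01; have gm := monotone_expect F p01 gi le01.
move: fm gm; set f1 := expect p F f _; set f0' := expect p F f _.
set g1 := expect p F g _; set g0' := expect p F g _.
set h1 := expect p F _ _; set h0 := expect p F _ _ => fm gm H0 H1.
have /andP[p0 p1] := p01.
have q0 : 0 <= 1 - p by rewrite subr_ge0.
have E : (p * f0' + (1 - p) * f1) * (p * g0' + (1 - p) * g1) =
  p * (f0' * g0') + (1 - p) * (f1 * g1) - p * (1 - p) * ((f0' - f1) * (g0' - g1)) by ring.
have C : 0 <= p * (1 - p) * ((f0' - f1) * (g0' - g1)).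
  by rewrite mulr_ge0 ?mulr_ge0 // subr_ge0.
have := ler_wpM2l p0 H1; have := ler_wpM2l q0 H0.
rewrite E; lra.
Qed.

Lemma depends_on_sub F F' A : {subset F <= F'} -> depends_on F A -> depends_on F' A.
Proof. by move=> FF' FA w w' ww'; apply: FA => e /FF' /ww'. Qed.

Definition indicator A w : R := (`[< A w >])%:R.

Lemma indicatorI A B w : indicator (A `&` B) w = indicator A w * indicator B w.
Proof. by rewrite /indicator asbool_and; do 2!case: asbool; rewrite /= ?mulr0 ?mulr1. Qed.

Lemma monotone_indicator A : increasing_event A -> monotone_fun (indicator A).
Proof.
move=> Ai w w' ww'; rewrite /indicator ler_nat.
by case: asboolP => // /(Ai _ _ ww') /asboolT ->.
Qed.

(** The statement with a conditioning on [F1] is the one that passes through the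
induction: splitting according to the state of the first edge of [F2] moves it to
[F1]. *)
Lemma prob_depends_on_cylinder p (P : probability cfg R) F1 F2 (a : cfg) A :
  is_bernoulli_percolation p P -> uniq (F1 ++ F2) -> depends_on (F1 ++ F2) A ->
  measurable (A `&` cylinder F1 a) /\
  P (A `&` cylinder F1 a) =
    ((\prod_(e <- F1) bernoulli_pmf p (a e)) * expect p F2 (indicator A) a)%:E.
Proof.
move=> hP; elim: F2 F1 a => [|e F2 IHF] F1 a.
  rewrite cats0 => uF1 FA; rewrite /= /indicator; case: asboolP => Aa.
    rewrite (_ : A `&` cylinder F1 a = cylinder F1 a).
      by rewrite mulr1 hP //; split=> //; exact: measurable_cylinder.
    apply/seteqP; split=> w; first by case.
    by move=> wF; split=> //; apply: FA Aa => e eF; rewrite wF.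
  rewrite (_ : A `&` cylinder F1 a = set0).
    by rewrite mulr0 measure0; split=> //; exact: (@measurable0 _ cfg).
  apply/seteqP; split=> w // [Aw wF]; apply: Aa; apply: FA Aw => e eF.
  by rewrite wF.
move=> uF FA.
have [uF' eF1] : uniq ((e :: F1) ++ F2) /\ e \notin F1.
  move: uF; rewrite uniq_catC /= mem_cat negb_or => /andP[/andP[eF2 eF1] u].
  by split=> //; rewrite mem_cat negb_or eF1 eF2 uniq_catC.
have FA' : depends_on ((e :: F1) ++ F2) A.
  by apply: depends_on_sub FA => e'; rewrite !(mem_cat, inE); do !case: (_ \in _) || case: (_ == _).
have split_state (b : bool) : cylinder (e :: F1) (set_state a e b) =
    cylinder F1 a `&` [set w : cfg | w e = b].
  apply/seteqP; split=> w.
    move=> wF; split=> [e' e'F|]; last by rewrite /= wF ?mem_head // set_state_same.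
    rewrite wF ?inE ?e'F ?orbT // /set_state.
    by case: eqP e'F eF1 => // -> ->.
  move=> [wF we] e'; rewrite inE /set_state; case: eqP => [->//|_ /=]; exact: wF.
have [m1 P1] := IHF (e :: F1) (set_state a e true) uF' FA'.
have [m0 P0] := IHF (e :: F1) (set_state a e false) uF' FA'.
have AE : A `&` cylinder F1 a = (A `&` cylinder (e :: F1) (set_state a e true))
    `|` (A `&` cylinder (e :: F1) (set_state a e false)).
  rewrite !split_state -setIUr -setIUr; congr (_ `&` _).
  by apply/seteqP; split=> w; [move=> wF; split=> //=; case: (w e); [left|right]|case].
have prodE (b : bool) : \prod_(e' <- e :: F1) bernoulli_pmf p (set_state a e b e') =
    bernoulli_pmf p b * \prod_(e' <- F1) bernoulli_pmf p (a e').
  rewrite big_cons set_state_same; congr (_ * _); apply: eq_big_seq => e' e'F.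
  by rewrite /set_state; case: eqP e'F eF1 => // -> ->.
rewrite AE; split; first exact: measurableU.
rewrite measureU //; last first.
  rewrite !split_state; apply/seteqP; split=> w //= [[_ [_ we]] [_ [_]]].
  by rewrite /= we.
apply: (etrans (congr2 (fun x y => (x + y)%E) P1 P0)).
rewrite !prodE -EFinD; congr EFin => /=; ring.
Qed.

Lemma prob_depends_on p (P : probability cfg R) F A (a : cfg) :
  is_bernoulli_percolation p P -> uniq F -> depends_on F A ->
  measurable A /\ P A = (expect p F (indicator A) a)%:E.
Proof.
move=> hP uF FA; have [] := prob_depends_on_cylinder (F1 := [::]) a hP uF FA.
rewrite (_ : A `&` cylinder _ a = A); first by rewrite big_nil mul1r.
by apply/seteqP; split=> w; [case|split].
Qed.

End FiniteExpectation.

(** * Increasing events: Harris' inequality and monotonicity in the parameter *)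

Section IncreasingEvents.
Variables (V : countType) (adj : rel V).
Local Notation cfg := (config adj).
Variable (R : realType).
Implicit Types (w : cfg) (e : edge adj) (A B : set cfg) (p : R).

Definition truncate (n : nat) w : cfg := fun e => w e && (pickle e < n)%N.

Definition first_edges (n : nat) : seq (edge adj) := pmap pickle_inv (iota 0 n).

Lemma uniq_first_edges n : uniq (first_edges n).
Proof. by apply: pmap_uniq (iota_uniq 0 n); exact: pickle_invK. Qed.

Lemma mem_first_edges n e : (e \in first_edges n) = (pickle e < n)%N.
Proof.
rewrite /first_edges mem_pmap; apply/mapP/idP => [[k]|en].
  rewrite mem_iota /= => kn /esym ek.
  by have := @pickle_invK (edge adj) k; rewrite ek /= => ->.
by exists (pickle e); rewrite ?mem_iota // pickleK_inv.
Qed.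

(** Finitely many open edges are enough for the event to occur. For an increasing event
this makes it the increasing union of its truncations, which is how it inherits
the inequalities on finite sets of edges. *)
Definition finitary A := forall w, A w -> exists n, A (truncate n w).

Definition truncated (n : nat) A : set cfg := [set w | A (truncate n w)].

Lemma truncate_le n w : config_le (truncate n w) w.
Proof. by move=> e /andP[]. Qed.

Lemma increasing_truncated n A : increasing_event A -> increasing_event (truncated n A).
Proof.
move=> Ai w w' ww'; apply: Ai => e /andP[we en].
by apply/andP; split=> //; exact: ww'.
Qed.

Lemma depends_on_truncated n A : depends_on (first_edges n) (truncated n A).
Proof.
move=> w w' ww'; rewrite /truncated /= (_ : truncate n w = truncate n w') //.
apply/funext => e; rewrite /truncate; case: ltnP => en; rewrite ?andbF //.
by rewrite ww' // mem_first_edges.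
Qed.

Lemma truncated_bigcup A : increasing_event A -> finitary A -> A = \bigcup_n truncated n A.
Proof.
move=> Ai Af; apply/seteqP; split=> w; first by move=> /Af[n An]; exists n.
by move=> [n _]; apply: Ai; exact: truncate_le.
Qed.

Lemma truncated_nondecreasing A : increasing_event A ->
  {homo (fun n => truncated n A) : n m / (n <= m)%N >-> (n <= m)%O}.
Proof.
move=> Ai n m nm; apply/subsetPset => w; apply: Ai => e /andP[we en].
by rewrite /truncate we (leq_trans en).
Qed.

Lemma measurable_finitary p (P : probability cfg R) A :
  is_bernoulli_percolation p P -> increasing_event A -> finitary A -> measurable A.
Proof.
move=> hP Ai Af; rewrite (truncated_bigcup Ai Af).
apply: bigcup_measurable => n _.
exact: (prob_depends_on (fun=> true) hP (uniq_first_edges n) (@depends_on_truncated n A)).1.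
Qed.

Lemma fine_expect_cvg p (P : probability cfg R) A :
  is_bernoulli_percolation p P -> increasing_event A -> finitary A ->
  (fun n => expect p (first_edges n) (indicator R (truncated n A)) (fun=> true))
    @ \oo --> fine (P A).
Proof.
move=> hP Ai Af.
have mA := measurable_finitary hP Ai Af.
have Pn n := prob_depends_on (fun=> true) hP (uniq_first_edges n) (@depends_on_truncated n A).
have mAn n : measurable (truncated n A) by have [] := Pn n.
have mU : measurable (\bigcup_n truncated n A) by exact: bigcup_measurable.
have := nondecreasing_cvg_mu (mu := P) mAn mU (truncated_nondecreasing Ai).
rewrite -truncated_bigcup // => cvgP.
have PA : P A \is a fin_num by exact: fin_num_measure.
have {}cvgP : P (truncated n A) @[n --> \oo] --> (fine (P A))%:E by rewrite fineK.
rewrite -(_ : fine \o (fun n => P (truncated n A)) = fun n =>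
  expect p (first_edges n) (indicator R (truncated n A)) (fun=> true)).
  exact: fine_cvg.
by apply/funext => n /=; have [_ ->] := Pn n.
Qed.

Lemma prob_harris p (P : probability cfg R) A B :
  0 <= p <= 1 -> is_bernoulli_percolation p P ->
  increasing_event A -> finitary A -> increasing_event B -> finitary B ->
  fine (P A) * fine (P B) <= fine (P (A `&` B)).
Proof.
move=> p01 hP Ai Af Bi Bf.
have ABi : increasing_event (A `&` B) by move=> w w' ww' [/(Ai _ _ ww') ? /(Bi _ _ ww')].
have ABf : finitary (A `&` B).
  move=> w [/Af[n An] /Bf[m Bm]]; exists (maxn n m).
  split; [apply: Ai An|apply: Bi Bm] => e /andP[we en]; apply/andP; split=> //.
    by rewrite (leq_trans en) // leq_maxl.
  by rewrite (leq_trans en) // leq_maxr.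
apply: (@ler_cvg_to _ \oo _ R _ _ _ _ (cvgM (fine_expect_cvg hP Ai Af) (fine_expect_cvg hP Bi Bf))
  (fine_expect_cvg hP ABi ABf)).
apply: nearW => n.
rewrite (_ : indicator R (truncated n (A `&` B)) =
    fun w => indicator R (truncated n A) w * indicator R (truncated n B) w).
  apply: expect_harris => //; try by move=> w; exact: ler0n.
    exact: monotone_indicator (increasing_truncated (n := n) Ai).
  exact: monotone_indicator (increasing_truncated (n := n) Bi).
by apply/funext => w; rewrite -indicatorI.
Qed.

Lemma prob_le_param p p' (P P' : probability cfg R) A :
  0 <= p -> p <= p' -> p' <= 1 ->
  is_bernoulli_percolation p P -> is_bernoulli_percolation p' P' ->
  increasing_event A -> finitary A -> fine (P A) <= fine (P' A).
Proof.
move=> p0 pp' p'1 hP hP' Ai Af.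
apply: (@ler_cvg_to _ \oo _ R _ _ _ _ (fine_expect_cvg hP Ai Af) (fine_expect_cvg hP' Ai Af)).
apply: nearW => n; apply: expect_le_param => //.
exact: monotone_indicator (increasing_truncated (n := n) Ai).
Qed.

End IncreasingEvents.

(** * Open paths and clusters *)

Section Connections.
Variables (V : countType) (adj : rel V).
Local Notation cfg := (config adj).
Implicit Types (w : cfg) (e : edge adj) (x y z : V).

Lemma open_adj_sym w x y : open_adj w x y -> open_adj w y x.
Proof. by case=> e [we []]; exists e; split=> //; [right|left]. Qed.

Lemma joined_refl w x : joined w x x.
Proof. by exists [::]. Qed.

Lemma joined_trans w x y z : joined w x y -> joined w y z -> joined w x z.
Proof.
move=> [s [ps ls]] [t [pt lt]]; exists (s ++ t).
by rewrite cat_path ps ls last_cat ls.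
Qed.

Lemma joined_open w x y : open_adj w x y -> joined w x y.
Proof. by move=> xy; exists [:: y] => /=; rewrite andbT asboolT. Qed.

Lemma joined_sym w x y : joined w x y -> joined w y x.
Proof.
move=> [s [ps <-]]; elim: s x ps => [|z s IHs] x /=; first by move=> _; exact: joined_refl.
move=> /andP[/asboolP xz /IHs zx]; apply: joined_trans zx _.
exact/joined_open/open_adj_sym.
Qed.

(** Induction along an open path, the only way in which paths are taken apart below. *)
Lemma joined_closed w (Q : V -> Prop) x y :
  (forall u v, open_adj w u v -> Q u -> Q v) -> Q x -> joined w x y -> Q y.
Proof.
move=> Qw + [s [+ <-]]; elim: s x => [//|z s IHs] x Qx /= /andP[/asboolP xz].
by apply: IHs; exact: Qw xz Qx.
Qed.

Lemma joined_step w w' x y : (forall u v, open_adj w u v -> joined w' u v) ->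
  joined w x y -> joined w' x y.
Proof.
move=> ww'; apply: (joined_closed (Q := joined w' x)); last exact: joined_refl.
by move=> u v /ww' uv xu; exact: joined_trans uv.
Qed.

Lemma open_adj_le w w' x y : config_le w w' -> open_adj w x y -> open_adj w' x y.
Proof. by move=> ww' [e [/ww' we xy]]; exists e. Qed.

Lemma joined_increasing x y : increasing_event [set w : cfg | joined w x y].
Proof.
move=> w w' ww'; apply: joined_step => u v uv.
exact: joined_open (open_adj_le ww' uv).
Qed.

Lemma joined_finitary x y : finitary [set w : cfg | joined w x y].
Proof.
move=> w /=; apply: (joined_closed (Q := fun z => exists n, joined (truncate n w) x z)).
  move=> u v [e [we uv]] [n xu]; exists (maxn n (pickle e).+1).
  have le_tr : config_le (truncate n w) (truncate (maxn n (pickle e).+1) w).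
    by move=> e' /andP[we' e'n]; rewrite /truncate we' leq_max e'n.
  apply: joined_trans (joined_increasing le_tr xu) _.
  by apply: joined_open; exists e; split=> //; rewrite /truncate we leq_max leqnn orbT.
by exists 0%N; exact: joined_refl.
Qed.

Lemma measurable_joined x y : measurable [set w : cfg | joined w x y].
Proof.
have mo u v : measurable [set w : cfg | open_adj w u v].
  apply: measurable_exists => e.
  exact: measurable_conj (measurable_state e true)
    (measurable_const (val e = (u, v) \/ val e = (v, u))).
apply: measurable_exists => s.
suff mp : measurable [set w : cfg | path (fun u v => `[< open_adj w u v >]) x s].
  exact: measurable_conj mp (measurable_const (last x s = y)).
elim: s x => [|z s IHs] x; first exact: (measurable_const true).
apply: (measurable_ext _ (measurable_conj (mo x z) (IHs z))) => w /=.
by split=> [[/asboolT -> ->]|/andP[/asboolP]].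
Qed.

Lemma measurable_infinite_cluster x : measurable [set w : cfg | infinite_set (Defs.cluster w x)].
Proof.
have mE n : measurable [set w : cfg | exists s : seq V,
    (uniq s /\ size s = n) /\ forall y, y \in s -> joined w x y].
  apply: measurable_exists => s.
  apply: (measurable_conj (measurable_const (uniq s /\ size s = n))).
  apply: measurable_forall => y; apply: measurable_imply => _; exact: measurable_joined.
apply: (measurable_ext _ (measurable_forall mE)) => w /=; split=> [wn|wi n].
  apply/infinite_set_fsetP => n; have [s [[us <-] ws]] := wn n.
  exists (seq_fset tt s); last by rewrite size_seq_fset undup_id.
  by move=> y ys; apply: ws; rewrite -(seq_fsetE tt).
have [B Bw nB] := infinite_set_fset n wi.
exists (take n (enum_fset B)); split; first by rewrite take_uniq ?fset_uniq // size_takel.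
by move=> y /mem_take /Bw.
Qed.

End Connections.

(** * Graph automorphisms *)

Section Automorphisms.
Variables (V : countType) (adj : rel V).
Local Notation cfg := (config adj).
Implicit Types (w : cfg) (e : edge adj) (x y z : V).

Definition automorphism (f : V -> V) : Prop :=
  exists g, [/\ cancel f g, cancel g f & forall x y, adj (f x) (f y) = adj x y].

(** The pullback of [w] by [f]. It goes through [open_adj] because [f] may map
the stored orientation of an edge to the opposite one. *)
Definition relabel (f : V -> V) w : cfg :=
  fun e => `[< open_adj w (f (val e).1) (f (val e).2) >].

Hypothesis adj_sym : symmetric adj.

Lemma edge_between x y : adj x y -> x != y ->
  exists e, val e = (x, y) \/ val e = (y, x).
Proof.
move=> xy nxy; have : pickle x != pickle y.
  by apply: contra nxy => /eqP/(pcan_inj pickleK)->.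
rewrite neq_ltn => /orP[lt|lt].
  have xyP : adj (x, y).1 (x, y).2 && (pickle (x, y).1 < pickle (x, y).2)%N by rewrite /= xy.
  by exists (exist _ (x, y) xyP); left.
have yxP : adj (y, x).1 (y, x).2 && (pickle (y, x).1 < pickle (y, x).2)%N.
  by rewrite /= adj_sym xy.
by exists (exist _ (y, x) yxP); right.
Qed.

Lemma edge_unique e e' : val e = ((val e').2, (val e').1) \/ val e = val e' -> e = e'.
Proof.
move=> [ee'|/val_inj//].
have /andP[_] := valP e; have /andP[_] := valP e'; rewrite ee' /= => lt.
by rewrite ltnNge ltnW.
Qed.

Lemma edge_ends e : (val e).1 != (val e).2.
Proof.
by have /andP[_] := valP e; apply: contraTneq => ->; rewrite ltnn.
Qed.

Lemma relabel_edge f : injective f -> (forall x y, adj (f x) (f y) = adj x y) ->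
  exists2 h : edge adj -> edge adj, injective h & forall w, relabel f w = w \o h.
Proof.
move=> finj fadj.
have hP e : exists e', val e' = (f (val e).1, f (val e).2) \/ val e' = (f (val e).2, f (val e).1).
  apply: edge_between; last by rewrite (inj_eq finj) edge_ends.
  by rewrite fadj; have /andP[] := valP e.
have [h hE] := choice hP.
have E w e : relabel f w e = w (h e).
  rewrite /relabel; apply/asboolP/idP => [[e' [we' e'E]]|whe]; last first.
    by exists (h e); split=> //; exact: hE.
  rewrite (_ : h e = e') //; apply: edge_unique.
  by case: e'E (hE e) => -> [->|->]; [right|left|left|right].
exists h => [e1 e2 h12|w]; last by apply/funext.
apply: edge_unique.
have := hE e1; have := hE e2; rewrite h12.
case: (val e1) (val e2) => x1 y1 [x2 y2] /=.
by move=> [->|->] [] [] /finj -> /finj ->; by [left|right].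
Qed.

(** An automorphism permutes the edges, so it maps cylinders to cylinders of the same
probability. *)
Lemma prob_relabel (R : realType) (p : R) (P : probability cfg R) f (A : set cfg) :
  is_bernoulli_percolation p P -> automorphism f -> measurable A ->
  P (relabel f @^-1` A) = P A.
Proof.
move=> hP [g [fK gK fadj]] mA.
have [h hinj hE] := relabel_edge (can_inj fK) fadj.
have mT : measurable_fun [set: cfg] (relabel f).
  apply: measurable_config_map => e.
  by apply: (measurable_ext _ (measurable_state (h e) true)) => w /=; rewrite hE.
pose m1 : {measure set cfg -> \bar R} := pushforward P (relabel f).
suff : m1 mT A = P A by [].
apply: eq_measure_cylinder mA.
  by rewrite (_ : m1 mT setT = P setT) // probability_setT ltry.
move=> F a uF.
suff : P (relabel f @^-1` cylinder F a) = P (cylinder F a) by [].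
pose a' e' := `[< exists e, [/\ e \in F, h e = e' & a e] >].
have a'E e : e \in F -> a' (h e) = a e.
  move=> eF; apply/asboolP/idP => [[e' [_ /hinj ->//]]|ae]; by exists e.
have -> : relabel f @^-1` cylinder F a = cylinder (map h F) a'.
  apply/seteqP; split=> w /= wF e; last first.
    by move=> eF; rewrite hE /= wF ?map_f // a'E.
  by move=> /mapP[e' e'F ->]; rewrite a'E // -wF // hE.
rewrite !hP ?map_inj_uniq // big_map; congr EFin.
by apply: eq_big_seq => e eF; rewrite a'E.
Qed.

Lemma open_adj_relabel f w x y : injective f ->
  open_adj (relabel f w) x y -> open_adj w (f x) (f y).
Proof.
move=> finj [e [/asboolP ww [E|E]]]; move: ww; rewrite E /= //.
exact: open_adj_sym.
Qed.

Lemma relabel_open_adj f w x y : injective f -> (forall x y, adj (f x) (f y) = adj x y) ->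
  open_adj w (f x) (f y) -> open_adj (relabel f w) x y.
Proof.
move=> finj fadj fxy.
have [e [we eE]] := fxy.
have afxy : adj (f x) (f y) && (f x != f y).
  have /andP[ae _] := valP e; have ne := edge_ends e.
  by case: eE => E; move: ae ne; rewrite E /= => ae ne; rewrite ?ne ?andbT // adj_sym ae eq_sym.
have [e' e'E] : exists e', val e' = (x, y) \/ val e' = (y, x).
  by apply: edge_between; case/andP: afxy; rewrite ?fadj ?(inj_eq finj).
exists e'; split=> //; apply/asboolP.
by case: e'E => -> //=; exact: open_adj_sym.
Qed.

Lemma joined_relabel f w x y : automorphism f ->
  joined (relabel f w) x y <-> joined w (f x) (f y).
Proof.
move=> [g [fK gK fadj]]; have finj := can_inj fK; split.
  apply: (joined_closed (Q := fun z => joined w (f x) (f z))); last exact: joined_refl.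
  move=> u v /(open_adj_relabel finj) uv xu; exact: joined_trans (joined_open uv).
move=> xy; rewrite -[y]fK.
apply: (joined_closed (Q := fun z => joined (relabel f w) x (g z))) xy.
  move=> u v uv xu; apply: (joined_trans xu); apply: joined_open.
  by apply: relabel_open_adj => //; rewrite !gK.
by rewrite fK; exact: joined_refl.
Qed.

Lemma automorphism_comp f g : automorphism f -> automorphism g -> automorphism (f \o g).
Proof.
move=> [f' [fK f'K fadj]] [g' [gK g'K gadj]]; exists (g' \o f'); split.
- exact: can_comp.
- exact: can_comp.
- by move=> x y /=; rewrite fadj gadj.
Qed.

End Automorphisms.

(** * Countable families of events, and Fekete's lemma *)

Section Probability.
Context {d : measure_display} {T : measurableType d} {R : realType} (P : probability T R).

Lemma markov_count_seq (I : choiceType) (J : I -> set T) (K : nat) (s : seq I) :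
  (forall i, measurable (J i)) ->
  measurable [set w | (K <= count (fun i => `[< J i w >]) s)%N] /\
  (K%:R%:E * P [set w | (K <= count (fun i => `[< J i w >]) s)%N] <= \sum_(i <- s) P (J i))%E.
Proof.
move=> mJ.
have mf i : measurable_fun setT (EFin \o (\1_(J i) : T -> R)).
  exact/measurable_EFinP/measurable_indic.
have sumE w : (\sum_(i <- s) (\1_(J i) w)%:E = (count (fun i => `[< J i w >]) s)%:R%:E :> \bar R)%E.
  rewrite sumEFin; congr EFin; elim: s => [|i s IHs] /=; first by rewrite big_nil.
  rewrite big_cons IHs natrD indicE; congr ((nat_of_bool _)%:R + _).
have ms : measurable_fun setT (fun w => \sum_(i <- s) (\1_(J i) w : R)%:E)%E.
  by apply: emeasurable_sum => i; exact: mf.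
have mE : measurable [set w | (K <= count (fun i => `[< J i w >]) s)%N].
  have -> : [set w | (K <= count (fun i => `[< J i w >]) s)%N] =
      setT `&` [set w | (K%:R%:E <= \sum_(i <- s) (\1_(J i) w : R)%:E)%E].
    by apply/seteqP; split=> w /=; rewrite sumE lee_fin ler_nat => // -[].
  exact: emeasurable_fun_c_infty measurableT ms _.
split=> //.
set E := [set w | _] in mE *.
have mI : measurable_fun setT (fun w => (\1_E w : R)%:E).
  exact/measurable_EFinP/measurable_indic.
have -> : (K%:R%:E * P E = \int[P]_w (K%:R%:E * (\1_E w)%:E))%E.
  by rewrite ge0_integralZl_EFin // integral_indic // setIT.
have -> : (\sum_(i <- s) P (J i) = \sum_(i <- s) \int[P]_w (\1_(J i) w)%:E)%E.
  by apply: eq_bigr => i _; rewrite integral_indic // setIT.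
rewrite -ge0_integral_sum //.
apply: ge0_le_integral => //.
- by apply: measurable_funeM.
move=> w _; rewrite sumE -EFinM lee_fin indicE.
case: (boolP (w \in E)) => [|_]; last by rewrite mulr0 ler0n.
by rewrite mulr1 ler_nat inE.
Qed.

(** Markov's inequality for the number of events of the family that occur. When only
the events in an initial segment of an enumeration of [I] are counted, this is the finite
case, with the same bound [M] for all segments; the segments then exhaust [I]. *)
Lemma markov_count (I : countType) (J : I -> set T) (K : nat) (M : R) :
  (forall i, measurable (J i)) ->
  (forall s, uniq s -> (\sum_(i <- s) P (J i) <= M%:E)%E) ->
  measurable [set w | exists s : seq I, [/\ uniq s, size s = K & forall i, i \in s -> J i w]] /\
  (K%:R%:E * P [set w | exists s : seq I, [/\ uniq s, size s = K & forall i, i \in s -> J i w]]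
    <= M%:E)%E.
Proof.
move=> mJ hM.
pose enum_upto n : seq I := pmap pickle_inv (iota 0 n).
have mem_upto n i : (i \in enum_upto n) = (pickle i < n)%N.
  rewrite /enum_upto mem_pmap; apply/mapP/idP => [[k]|en].
    rewrite mem_iota /= => kn /esym ek.
    by have := @pickle_invK I k; rewrite ek /= => ->.
  by exists (pickle i); rewrite ?mem_iota // pickleK_inv.
have uniq_upto n : uniq (enum_upto n).
  by apply: pmap_uniq (iota_uniq 0 n); exact: pickle_invK.
pose E n := [set w | (K <= count (fun i => `[< J i w >]) (enum_upto n))%N].
have mE n : measurable (E n) by have [] := markov_count_seq K (enum_upto n) mJ.
have -> : [set w | exists s : seq I, [/\ uniq s, size s = K & forall i, i \in s -> J i w]] =
    \bigcup_n E n.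
  apply/seteqP; split=> w /=.
    move=> [s [us sK ws]]; exists (\max_(i <- s) (pickle i).+1) => //.
    rewrite /E /= -size_filter -sK; apply: uniq_leq_size => // i si.
    rewrite mem_filter mem_upto; apply/andP; split; first exact/asboolP/ws.
    exact: (leq_bigmax_seq (F := fun i => (pickle i).+1)).  
  move=> [n _]; rewrite /E /= -size_filter => Kn.
  exists (take K [seq i <- enum_upto n | `[< J i w >]]); split.
  - by rewrite take_uniq // filter_uniq.
  - by rewrite size_takel.
  - by move=> i /mem_take; rewrite mem_filter => /andP[/asboolP].
have mU : measurable (\bigcup_n E n) by exact: bigcup_measurable.
split=> //.
have Emono : {homo E : n m / (n <= m)%N >-> (n <= m)%O}.
  move=> n m nm; apply/subsetPset => w; rewrite /E /= => Kn.
  apply: leq_trans Kn _; rewrite -!size_filter; apply: uniq_leq_size.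
    exact: filter_uniq.
  move=> i; rewrite !mem_filter !mem_upto => /andP[-> /=] /leq_trans; exact.
have := nondecreasing_cvg_mu (mu := P) mE mU Emono.
move=> cvgE.
have : (K%:R%:E * (P \o E) n)%E @[n --> \oo] --> (K%:R%:E * P (\bigcup_n E n))%E.
  by apply: cvgeZl.
move=> /cvge_to_le; apply; apply: nearW => n /=.
have [_ le1] := markov_count_seq K (enum_upto n) mJ.
exact: le_trans le1 (hM _ (uniq_upto n)).
Qed.

(** For summing a bound that holds separately on each possible outcome of the
exploration. *)
Lemma measure_bigcup_scale (I : countType) (B B' : I -> set T) (c : R) :
  0 <= c -> (forall i, measurable (B i)) -> (forall i, measurable (B' i)) ->
  (forall i, B' i `<=` B i) -> (forall i j w, B i w -> B j w -> i = j) ->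
  (forall i, (c%:E * P (B i) <= P (B' i))%E) ->
  (c%:E * P (\bigcup_i B i) <= P (\bigcup_i B' i))%E.
Proof.
move=> c0 mB mB' BB' disj le1.
pose F (C : I -> set T) n := if pickle_inv n is Some i then C i else set0.
have FE (C : I -> set T) : \bigcup_i C i = \bigcup_n F C n.
  apply/seteqP; split=> w [].
    by move=> i _ Ci; exists (pickle i) => //; rewrite /F pickleK_inv.
  by move=> n _; rewrite /F; case: pickle_inv => // i Ci; exists i.
have mF (C : I -> set T) : (forall i, measurable (C i)) -> forall n, measurable (F C n).
  by move=> mC n; rewrite /F; case: pickle_inv.
have tF (C : I -> set T) : (forall i, C i `<=` B i) -> trivIset setT (F C).
  move=> CB n m _ _ [w []]; rewrite /F.
  case En: (pickle_inv n) => [i|//]; case Em: (pickle_inv m) => [j|//].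
  move=> /CB Ci /CB /(disj _ _ _ Ci) ij.
  by have := @pickle_invK I n; have := @pickle_invK I m; rewrite En Em /= ij => <- <-.
rewrite !FE (measure_bigcup P _ _ (fun n _ => mF B mB n) (tF B (fun i => @subset_refl _ _))).
rewrite (measure_bigcup P _ _ (fun n _ => mF B' mB' n) (tF B' BB')).
rewrite -nneseriesZl => [|n _]; last exact: measure_ge0.
apply: lee_nneseries => n.
  by move=> _ _; rewrite mule_ge0.
by move=> _; rewrite /F; case: pickle_inv => //; rewrite !measure0 mule0.
Qed.

Lemma negligible_exists (I : countType) (B : I -> set T) :
  (forall i, P.-negligible (B i)) -> P.-negligible [set w | exists i, B i w].
Proof.
move=> nB; pose F n := if pickle_inv n is Some i then B i else set0.
apply: (negligibleS (A := \bigcup_n F n)); last first.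
  apply: negligible_bigcup => n; rewrite /F; case: pickle_inv => //.
  exact: negligible_set0.
by move=> w [i Bi]; exists (pickle i) => //; rewrite /F pickleK_inv.
Qed.

End Probability.

(** Fekete's lemma, for [t = exp a] with [a] superadditive. Euclidean division of [n] by [m]
gives [a n / n >= a m / m + O(1 / n)], so [a n / n] converges to its supremum. *)
Lemma supermultiplicative_le_lim (R : realType) (t : nat -> R) :
  t 0%N = 1 -> (forall n, 0 < t n <= 1) -> (forall m n, t m * t n <= t (m + n)%N) ->
  forall m, t m <= limn (fun n => t n `^ (n%:R)^-1) ^+ m.
Proof.
move=> t0 t01 tM.
have tp n : 0 < t n by have /andP[] := t01 n.
pose a n := ln (t n).
have a_le0 n : a n <= 0 by apply: ln_le0; have /andP[] := t01 n.
have a0 : a 0%N = 0 by rewrite /a t0 ln1.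
have aD m n : a m + a n <= a (m + n)%N.
  by rewrite /a -lnM ?posrE // ler_ln ?posrE ?mulr_gt0.
have aZ q m : q%:R * a m <= a (q * m)%N.
  elim: q => [|q IHq]; first by rewrite mul0r mul0n a0.
  by rewrite mulSn -natr1 mulrDl mul1r addrC (le_trans _ (aD _ _)) // lerD2l.
pose b n := (n%:R)^-1 * a n.
have b_le0 n : b n <= 0 by rewrite /b mulr_ge0_le0.
have b_low m n : (0 < m)%N -> (0 < n)%N -> b m + (n%:R)^-1 * (m%:R * a 1%N) <= b n.
  move=> m0 n0.
  have nR : 0 < n%:R :> R by rewrite ltr0n.
  have mR : 0 < m%:R :> R by rewrite ltr0n.
  rewrite /b -(ler_pM2l nR) mulrDr !mulrA mulfV ?gt_eqF // !mul1r.
  apply: le_trans (_ : (n %/ m)%:R * a m + (n %% m)%:R * a 1%N <= _); last first.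
    rewrite {3}(divn_eq n m) (le_trans _ (aD _ _)) // lerD //.
    by have := aZ (n %% m)%N 1%N; rewrite muln1.
  apply: lerD.
    rewrite ler_wnM2r // ler_pdivlMr // -natrM ler_nat; exact: leq_divM.
  by rewrite ler_wnM2r // ler_nat ltnW // ltn_mod.
pose S := [set b m | m in [set m | (0 < m)%N]].
have S_sup : has_sup S.
  split; first by exists (b 1%N), 1%N.
  by exists 0 => _ [m _ <-].
have b_cvg : b @ \oo --> sup S.
  apply/cvgrPdist_le => e e0.
  have [_ [m m0 <-] bm] := sup_adherent (divr_gt0 e0 (@ltr0n R 2)) S_sup.
  near=> n.
  have n0 : (0 < n)%N by near: n; exists 1%N.
  have bs : b n <= sup S by apply: sup_upper_bound => //; exists n.
  rewrite ger0_norm ?subr_ge0 //.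
  have := b_low m n m0 n0.
  have : - (e / 2) <= (n%:R)^-1 * (m%:R * a 1%N).
    rewrite ler_pdivlMl ?ltr0n // mulrN lerNl -ler_pdivrMr ?divr_gt0 //.
    near: n; exact: nbhs_infty_ger.
  have := bm; rewrite /=; lra.
have u_cvg : (fun n => t n `^ (n%:R)^-1) @ \oo --> expR (sup S).
  rewrite (_ : (fun n => _) = expR \o b).
    by apply: continuous_cvg => //; exact: continuous_expR.
  by apply/funext => n /=; rewrite /powR gt_eqF.
move=> m; rewrite (cvg_lim _ u_cvg) // -expRM_natl.
case: m => [|m]; first by rewrite mul0r expR0 t0.
rewrite -[t _]lnK ?posrE // ler_expR -/(a _).
have : b m.+1 <= sup S by apply: sup_upper_bound => //; exists m.+1.
by rewrite /b ler_pdivrMl // ltr0n.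
Unshelve. all: by end_near.
Qed.

(** * Connection probabilities *)

Section ConnectionProbability.
Variables (V : countType) (adj : rel V).
Local Notation cfg := (config adj).
Variables (R : realType) (p : R) (P : probability cfg R).
Hypothesis (p01 : 0 <= p <= 1) (hP : is_bernoulli_percolation p P).
Hypothesis adj_sym : symmetric adj.
Implicit Types (w : cfg) (x y z : V).

Definition conn x y : R := fine (P [set w | joined w x y]).

Lemma prob_joined x y : P [set w | joined w x y] = (conn x y)%:E.
Proof. by rewrite fineK // fin_num_measure //; exact: measurable_joined. Qed.

Lemma fine_prob_le (A B : set cfg) : measurable A -> measurable B -> A `<=` B ->
  fine (P A) <= fine (P B).
Proof.
move=> mA mB AB; rewrite fine_le ?fin_num_measure //.
by rewrite le_measure ?inE.
Qed.

Lemma conn_ge0 x y : 0 <= conn x y.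
Proof. exact: fine_ge0. Qed.

Lemma conn_le1 x y : conn x y <= 1.
Proof. by rewrite -lee_fin -prob_joined probability_le1 //; exact: measurable_joined. Qed.

Lemma conn_refl x : conn x x = 1.
Proof.
rewrite /conn (_ : [set w | joined w x x] = setT) ?probability_setT //.
by apply/seteqP; split=> // w _; exact: joined_refl.
Qed.

Lemma conn_supermul x y z : conn x y * conn y z <= conn x z.
Proof.
apply: le_trans (prob_harris p01 hP (@joined_increasing _ _ x y) (@joined_finitary _ _ x y)
  (@joined_increasing _ _ y z) (@joined_finitary _ _ y z)) _.
apply: fine_prob_le; [apply: measurableI| |]; try exact: measurable_joined.
by move=> w [xy yz]; exact: joined_trans yz.
Qed.

Lemma conn_automorphism f x y : automorphism adj f -> conn (f x) (f y) = conn x y.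
Proof.
move=> fA; rewrite /conn -(prob_relabel adj_sym hP fA (measurable_joined x y)).
congr (fine (P _)); apply/seteqP; split=> w /=; exact: (joined_relabel adj_sym w x y fA).2 ||
  exact: (joined_relabel adj_sym w x y fA).1.
Qed.

Lemma conn_adj x y : adj x y -> x != y -> p <= conn x y.
Proof.
move=> xy nxy; have [e eE] := edge_between adj_sym xy nxy.
have Pe : P (cylinder [:: e] (fun=> true)) = p%:E by rewrite hP // big_seq1.
rewrite -lee_fin -prob_joined -Pe; apply: le_measure; rewrite ?inE.
- exact: measurable_cylinder.
- exact: measurable_joined.
by move=> w /(_ e); rewrite mem_head => we; apply: joined_open; exists e; split=> //; exact: we.
Qed.

Lemma infinite_cluster_automorphism f x : automorphism adj f ->
  P [set w | infinite_set (Defs.cluster w (f x))] = P [set w | infinite_set (Defs.cluster w x)].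
Proof.
move=> fA; rewrite -(prob_relabel adj_sym hP fA (measurable_infinite_cluster x)).
congr (P _); have [g [fK gK _]] := fA.
have imE w : Defs.cluster w (f x) = f @` Defs.cluster (relabel f w) x.
  apply/seteqP; split=> [y xy|_ [y xy <-]].
    by exists (g y); rewrite ?gK //; apply/(joined_relabel adj_sym w x _ fA); rewrite gK.
  exact/(joined_relabel adj_sym w x _ fA).
have imE' w : Defs.cluster (relabel f w) x = g @` Defs.cluster w (f x).
  rewrite imE; apply/seteqP; split=> [y xy|_ [_ [y xy <-] <-]]; last by rewrite fK.
  by exists (f y); [exists y|rewrite fK].
apply/seteqP; split=> w /= inf fin; apply: inf.
  by rewrite imE; exact: finite_image.
by rewrite imE'; exact: finite_image.
Qed.

End ConnectionProbability.

(** * Exploration of a layered graph *)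

(** Percolation on a graph that is layered by a height function whose upward edges
form a matching between consecutive layers, as in a product with the line. *)
Section Layers.
Variables (V : countType) (adj : rel V).
Local Notation cfg := (config adj).
Hypothesis adj_sym : symmetric adj.
Variables (ht : V -> int) (up : V -> V).
Hypothesis adj_up : forall u, adj u (up u).
Hypothesis ht_up : forall u, ht (up u) = ht u + 1.
Hypothesis ht_adj : forall u v, adj u v -> ht v <= ht u \/ v = up u.
Variable o : V.
Implicit Types (w : cfg) (u v x y z : V) (k : int).

Lemma up_edge_exists : exists h : V -> edge adj,
  forall u, val (h u) = (u, up u) \/ val (h u) = (up u, u).
Proof.
have hP' u : exists e : edge adj, val e = (u, up u) \/ val e = (up u, u).
  by apply: edge_between => //; apply/eqP => /(congr1 ht); rewrite ht_up; lia.
have [h hE] := choice hP'; by exists h.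
Qed.

Definition below k w : cfg :=
  fun e => [&& w e, ht (val e).1 <= k & ht (val e).2 <= k].

(** The part of layer [k] that is found by exploring the cluster of [o] without
looking at any edge above layer [k]. *)
Definition front k w : set V := [set y | ht y = k /\ joined (below k w) o y].

Definition hits k : set cfg := [set w | exists y, ht y = k /\ joined w o y].

Lemma below_le k w : config_le (below k w) w.
Proof. by move=> e /and3P[]. Qed.

Lemma below_mono k k' w : k <= k' -> config_le (below k w) (below k' w).
Proof.
move=> kk' e /and3P[we h1 h2]; apply/and3P.
by split=> //; [exact: le_trans h1 kk'|exact: le_trans h2 kk'].
Qed.

Lemma open_adj_below k w u v : open_adj w u v -> ht u <= k -> ht v <= k ->
  open_adj (below k w) u v.
Proof.
by move=> [e [we uv]] hu hv; exists e; split=> //; apply/and3P; case: uv => ->.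
Qed.

Lemma open_adj_adj w u v : open_adj w u v -> adj u v.
Proof.
move=> [e [_ uv]]; have /andP[+ _] := valP e.
by case: uv => -> //=; rewrite adj_sym.
Qed.

(** The height rises by at most one along an edge, so a path from [o] stays in the explored
part until it leaves the front upwards. *)
Lemma leave_below k w y : ht o <= k -> joined w o y ->
  (ht y <= k /\ joined (below k w) o y) \/ exists2 u, front k w u & open_adj w u (up u).
Proof.
move=> ok; apply: (joined_closed (Q := fun y => (ht y <= k /\ joined (below k w) o y) \/
  exists2 u, front k w u & open_adj w u (up u))); last by left; split=> //; exact: joined_refl.
move=> u v uv [[uk ou]|]; last by right.
have [vk|vk] := lerP (ht v) k.
  left; split=> //; apply: joined_trans ou _; apply: joined_open.
  exact: open_adj_below.
right; have [|vE] := ht_adj (open_adj_adj uv); first by lia.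
exists u; last by rewrite -vE.
by split=> //; move: vk; rewrite vE ht_up; lia.
Qed.

Lemma hits_front k w : ht o <= k -> hits k w -> exists u, front k w u.
Proof.
move=> ok [y [yk oy]].
have [ok'|ok'] := lerP k (ht o).
  by exists o; split; [lia|exact: joined_refl].
have ok1 : ht o <= k - 1 by lia.
have [[]|[u [uk ou] uu]] := leave_below ok1 oy; first by lia.
exists (up u); split; first by rewrite ht_up; lia.
have ou' : joined (below k w) o u.
  by apply: joined_increasing ou; apply: below_mono; lia.
apply: joined_trans ou' _; apply/joined_open/open_adj_below; rewrite ?ht_up //; lia.
Qed.

Lemma front_hits k w u : front k w u -> hits k w.
Proof. by move=> [uk ou]; exists u; split=> //; apply: joined_increasing ou; exact: below_le. Qed.

Lemma hits_succ k w : ht o <= k -> hits (k + 1) w ->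
  exists2 u, front k w u & open_adj w u (up u).
Proof.
move=> ok [y [yk oy]]; have [[yk' _]|//] := leave_below ok oy.
by lia.
Qed.

Lemma hits_pred k w : ht o <= k -> hits (k + 1) w -> hits k w.
Proof. by move=> ok /(hits_succ ok)[u /front_hits]. Qed.

Lemma measurable_hits k : measurable (hits k).
Proof.
apply: measurable_exists => y.
exact: measurable_conj (measurable_const (ht y = k)) (measurable_joined o y).
Qed.

Lemma measurable_below k : measurable_fun setT (@below k).
Proof.
apply: measurable_config_map => e.
apply: (measurable_ext _ (measurable_conj (measurable_state e true)
  (measurable_const ((ht (val e).1 <= k) && (ht (val e).2 <= k))))) => w /=.
by rewrite /below; split=> [[-> ->]|/andP[]].
Qed.

Definition front_is k (S : {fset V}) : set cfg :=
  [set w | forall y, y \in enum_fset S <-> front k w y].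

Lemma measurable_front_is k S : measurable (front_is k S).
Proof.
apply: measurable_forall => y.
have mf : measurable [set w | front k w y].
  have mj : measurable [set w : cfg | joined (below k w) o y].
    have := measurable_below k; move=> /(_ measurableT _ (measurable_joined o y)).
    by rewrite setTI.
  exact: measurable_conj (measurable_const (ht y = k)) mj.
case: (y \in enum_fset S).
  by apply: (measurable_ext _ mf) => w; split=> [fy|H]; [split|exact/H].
apply: (measurable_ext _ (measurableC mf)) => w /=.
by split=> [nf|H]; [split=> // /nf|move=> /H].
Qed.

Lemma hits_le k (j : nat) w : ht o <= k -> hits (k + j%:Z) w -> hits k w.
Proof.
elim: j => [|j IHj] ok; first by rewrite addr0.
rewrite -addn1 PoszD addrA => /hits_pred hj; apply: IHj => //; apply: hj; lia.
Qed.

Lemma not_hits_bounded (i : nat) w y : ~ hits (ht o + i%:Z) w -> joined w o y ->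
  ht y < ht o + i%:Z.
Proof.
move=> nh oy; rewrite ltNge; apply/negP => hy; apply: nh.
have [j jE] : exists j : nat, ht y = ht o + i%:Z + j%:Z.
  by pose z : int := ht y - (ht o + i%:Z); exists (absz z); rewrite /z; lia.
apply: (@hits_le _ j); first lia.
by exists y.
Qed.

Definition crowded k n : set cfg := [set w | exists s : seq V,
  [/\ uniq s, size s = n & forall y, y \in s -> ht y = k /\ joined w o y]].

(** The first alternative is stated for the whole cluster, and not for the front, because
the first moment bound is about the whole cluster. *)
Lemma hits_front_is k n w : ht o <= k -> hits k w ->
  crowded k n.+1 w \/
  exists2 S : {fset V}, (0 < size (enum_fset S) <= n)%N & front_is k S w.
Proof.
move=> ok /(hits_front ok)[u fu].
have [|nc] := pselect (crowded k n.+1 w); first by left.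
have crowd (s : seq V) : uniq s -> (n < size s)%N -> (forall y, y \in s -> front k w y) -> False.
  move=> us ns sf; apply: nc; exists (take n.+1 s); split; rewrite ?take_uniq ?size_takel //.
  move=> y /mem_take /sf[yk oy]; split=> //; apply: joined_increasing oy; exact: below_le.
have [fin|inf] := pselect (finite_set (front k w)); last first.
  have [B Bf nB] := infinite_set_fset n.+1 inf.
  by exfalso; apply: (crowd (enum_fset B)); rewrite ?fset_uniq.
have [s sE] := (finite_seqP _).1 fin.
right; exists (seq_fset tt s) => [|y]; last first.
  by rewrite (seq_fsetE tt s y) sE.
apply/andP; split.
  have : u \in enum_fset (seq_fset tt s).
    by rewrite (seq_fsetE tt s u); move: fu; rewrite sE.
  by case: (enum_fset _).
rewrite leqNgt; apply/negP => ns; apply: (crowd _ _ ns); first exact: fset_uniq.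
by move=> y; rewrite (seq_fsetE tt s y) sE.
Qed.

Variables (R : realType) (p : R) (P : probability cfg R).
Hypothesis (p01 : 0 <= p <= 1) (hP : is_bernoulli_percolation p P).

(** If the front is a given set [S], closing the [#|S|] edges above it, which the
exploration has not looked at, keeps the cluster out of layer [k + 1]. *)
Lemma prob_confine k (S : {fset V}) (n : nat) :
  ht o <= k -> (size (enum_fset S) <= n)%N ->
  exists B, [/\ measurable B, B `<=` front_is k S, B `<=` ~` hits (k + 1) &
    (((1 - p) ^+ n)%:E * P (front_is k S) <= P B)%E].
Proof.
move=> ok Sn; have [h hE] := up_edge_exists.
have mS := measurable_front_is k S.
(* the filter only matters when [S] is not contained in layer [k]; then the event is empty *)
pose s := [seq h u | u <- enum_fset S & ht u == k].
have us : uniq s.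
  rewrite map_inj_in_uniq ?filter_uniq ?fset_uniq // => u v.
  rewrite !mem_filter => /andP[/eqP uk _] /andP[/eqP vk _] huv.
  have := hE u; have := hE v; rewrite huv.
  have upne a b : ht a = k -> ht b = k -> up a <> b.
    by move=> ak bk /(congr1 ht); rewrite ht_up; lia.
  by move=> [->|->] [] [] // E1 E2; exfalso; [apply: (upne u v)|apply: (upne u v)].
have inv w e (b : bool) : e \in s -> front_is k S w -> front_is k S (set_state w e b).
  move=> /mapP[u]; rewrite mem_filter => /andP[/eqP uk _] eE.
  have nk : (k + 1 <= k) = false by apply/negbTE; lia.
  rewrite /front_is /front /=.
  suff -> : below k (set_state w e b) = below k w by [].
  apply/funext => e'; rewrite /below /set_state; case: eqP => // ->.
  have := hE u; rewrite -eE => -[] -> /=; rewrite ht_up uk.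
    by rewrite nk !andbF.
  by rewrite nk /= !andbF.
exists (front_is k S `&` [set w | forall e, e \in s -> w e = false]); split.
- apply: measurableI => //; apply: measurable_forall => e; apply: measurable_imply => _.
  exact: measurable_state.
- by move=> w [].
- move=> w [wS ws] /(hits_succ ok)[u fu [e [we uu]]].
  have us' : h u \in s.
    by apply: map_f; rewrite mem_filter fu.1 eqxx; exact/wS.
  have eE : h u = e.
    apply: edge_unique; case: (hE u) uu => -> [] ->; by [left|right].
  by have := ws _ us'; rewrite eE we.
rewrite (prob_close p01 hP us mS inv).
apply: lee_wpmul2r => //; rewrite lee_fin.
case/andP: p01 => p0 p1.
apply: ler_wiXn2l; rewrite ?subr_ge0 // ?gerBl //.
by rewrite size_map (leq_trans _ Sn) // size_filter count_size.
Qed.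

Variable M : R.
Hypothesis layer_sum : forall k (s : seq V), uniq s -> (forall y, y \in s -> ht y = k) ->
  \sum_(y <- s) conn P o y <= M.

Lemma prob_crowded k n : measurable (crowded k n.+1) /\
  fine (P (crowded k n.+1)) <= M / n.+1%:R.
Proof.
pose J y := [set w : cfg | ht y = k /\ joined w o y].
have mJ y : measurable (J y).
  exact: measurable_conj (measurable_const (ht y = k)) (measurable_joined o y).
have sJ s : uniq s -> (\sum_(y <- s) P (J y) <= M%:E)%E.
  move=> us; rewrite (bigID (fun y => ht y == k)) /= [X in (_ + X)%E]big1 => [|y /eqP yk].
    rewrite adde0 (eq_bigr (fun y => (conn P o y)%:E)) => [|y /eqP yk].
      rewrite sumEFin lee_fin -big_filter; apply: (layer_sum (k := k)).
        exact: filter_uniq.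
      by move=> y; rewrite mem_filter => /andP[/eqP].
    rewrite -prob_joined; congr (P _).
    by apply/seteqP; split=> w; [case|split].
  by rewrite (_ : J y = set0) ?measure0 //; apply/seteqP; split=> w // [].
have [mC PC] := markov_count (P := P) n.+1 mJ sJ.
split; first exact: mC.
have nR : 0 < n.+1%:R :> R by rewrite ltr0n.
rewrite ler_pdivlMr // mulrC -lee_fin EFinM fineK // fin_num_measure //; exact: mC.
Qed.

(** The event that the cluster stops at layer [k] is at least as likely as the front
having at most [n] points, up to the factor [(1 - p) ^+ n]; and the front has more than
[n] points with probability at most [M / (n + 1)]. *)
Lemma hits_drop k n : ht o <= k ->
  (1 - p) ^+ n * (fine (P (hits k)) - M / n.+1%:R)
    <= fine (P (hits k)) - fine (P (hits (k + 1))).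
Proof.
move=> ok; have [mC PC] := prob_crowded k n.
pose F S := if (0 < size (enum_fset S) <= n)%N then front_is k S else set0.
have mF S : measurable (F S).
  by rewrite /F; case: ifP => _; [exact: measurable_front_is|exact: measurable0].
have q0 : 0 <= (1 - p) ^+ n by rewrite exprn_ge0 // subr_ge0; case/andP: p01.
have confine S : exists B, [/\ measurable B, B `<=` F S, B `<=` ~` hits (k + 1) &
    (((1 - p) ^+ n)%:E * P (F S) <= P B)%E].
  rewrite /F; case: ifP => [/andP[_ Sn]|_]; first exact: prob_confine.
  by exists set0; split=> //; rewrite measure0 mule0.
have [B /all_and4[mB BF Bh leB]] := choice confine.
have disj S S' w : F S w -> F S' w -> S = S'.
  rewrite /F; case: ifP => // _; case: ifP => // _ wS wS'.
  apply/fsetP => y; apply/idP/idP => yS.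
    exact/(wS' y)/(wS y).
  exact/(wS y)/(wS' y).
have le1 := measure_bigcup_scale (P := P) (I := ({fset V} : countType)) q0 mF mB BF disj leB.
have cS := @countableP ({fset V} : countType) setT.
have mUF : measurable (\bigcup_S F S) := countable_bigcupT_measurable cS mF.
have mUB : measurable (\bigcup_S B S) := countable_bigcupT_measurable cS mB.
have le2 : fine (P (hits k)) <= fine (P (\bigcup_S F S)) + M / n.+1%:R.
  apply: (@le_trans _ _ (fine (P (\bigcup_S F S)) + fine (P (crowded k n.+1)))).
    rewrite -lee_fin EFinD !fineK ?fin_num_measure //; try exact: measurable_hits.
    apply: le_trans (measureU2 _ _ _) => //.
    rewrite le_measure ?inE //; [exact: measurable_hits|exact: measurableU|].
    move=> w /(hits_front_is n ok)[wc|[S Sn wS]]; first by right.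
    by left; exists S => //; rewrite /F Sn.
  by rewrite lerD2l.
have le3 : fine (P (\bigcup_S B S)) <= fine (P (hits k)) - fine (P (hits (k + 1))).
  rewrite lerBrDr -lee_fin EFinD !fineK ?fin_num_measure //; try exact: measurable_hits.
  rewrite -measureU //; try exact: measurable_hits.
    rewrite le_measure ?inE //; try exact: measurable_hits.
      by apply: measurableU => //; exact: measurable_hits.
    move=> w [[S _ BS]|]; last exact: hits_pred.
    have := BF _ _ BS; rewrite /F; case: ifP => // /andP[S0 _] wS.
    case E : (enum_fset S) S0 => [//|u t] _.
    by apply: (@front_hits k w u); apply/wS; rewrite E mem_head.
  apply/seteqP; split=> w // [[S _ BS]]; exact: Bh BS.
have le4 : (1 - p) ^+ n * fine (P (\bigcup_S F S)) <= fine (P (\bigcup_S B S)).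
  by rewrite -lee_fin EFinM !fineK ?fin_num_measure.
apply: le_trans (le_trans le4 le3); rewrite ler_wpM2l // lerBlDr.
exact: le2.
Qed.

(** If the probabilities of reaching ever higher layers stayed above [c], then
taking [n] with [M / (n + 1) <= c / 2] they would decrease at each layer by at least
[(1 - p) ^ n * c / 2]. *)
Lemma hits_all_null : p < 1 -> P [set w | forall i : nat, hits (ht o + i%:Z) w] = 0%E.
Proof.
move=> p1; pose H : set cfg := [set w | forall i : nat, hits (ht o + i%:Z) w].
suff : P H = 0%E by [].
have mH : measurable H by apply: measurable_forall => i; exact: measurable_hits.
pose h (i : nat) := fine (P (hits (ht o + i%:Z))).
set c := fine (P H).
suff c0 : c = 0.
  by have /fineK <- : P H \is a fin_num by [exact: fin_num_measure]; rewrite -/c c0.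
apply/eqP; rewrite eq_le fine_ge0 // andbT leNgt; apply/negP => c0.
have ch i : c <= h i.
  by apply: fine_prob_le => //; exact: measurable_hits.
have M0 : 0 <= M.
  by have := layer_sum (k := 0) (s := [::]); rewrite big_nil; apply.
have [n Mn] : exists n : nat, M / n.+1%:R <= c / 2.
  have c2 : 0 < c / 2 by rewrite divr_gt0.
  exists (Num.bound (M / (c / 2))).
  rewrite ler_pdivrMr ?ltr0n // mulrC -ler_pdivrMr //.
  by apply: (le_trans (ltW (archi_boundP (divr_ge0 M0 (ltW c2))))); rewrite ler_nat leqnSn.
have q0 : 0 < (1 - p) ^+ n * (c / 2).
  by rewrite mulr_gt0 ?divr_gt0 // exprn_gt0 // subr_gt0.
have drop i : (1 - p) ^+ n * (c / 2) <= h i - h i.+1.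
  have oi : ht o <= ht o + i%:Z by lia.
  have := hits_drop n oi; rewrite -addrA -[_ + 1]/(i%:Z + 1%:Z) -PoszD addn1.
  apply: le_trans; apply: ler_wpM2l; first by rewrite exprn_ge0 // subr_ge0 ltW.
  move: (ch i) Mn; rewrite /h; move: (fine (P (hits (ht o + i%:Z)))) (M / _) => x y; lra.
have sum i : i%:R * ((1 - p) ^+ n * (c / 2)) <= h 0%N - h i.
  elim: i => [|i IHi]; first by rewrite mul0r subrr.
  rewrite -natr1 mulrDl mul1r; have := drop i; lra.
have h01 : h 0%N <= 1.
  have mh := measurable_hits (ht o + 0%N%:Z).
  by rewrite -lee_fin fineK ?fin_num_measure // probability_le1.
pose N := Num.bound ((1 - p) ^+ n * (c / 2))^-1.
have N1 : 1 < N%:R * ((1 - p) ^+ n * (c / 2)).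
  by rewrite -ltr_pdivrMr // div1r archi_boundP // invr_ge0 ltW.
move: (sum N) (ch N); lra.
Qed.

Lemma crowded_all_null k : P.-negligible [set w | forall n, crowded k n.+1 w].
Proof.
pose C : set cfg := [set w | forall n, crowded k n.+1 w].
have mC : measurable C.
  by apply: measurable_forall => n; have [] := prob_crowded k n.
exists C; split=> //.
suff c0 : fine (P C) = 0.
  by have /fineK <- : P C \is a fin_num by [exact: fin_num_measure]; rewrite c0.
apply/eqP; rewrite eq_le fine_ge0 // andbT leNgt; apply/negP => c0.
have le n : fine (P C) * n.+1%:R <= M.
  have [mn Pn] := prob_crowded k n; rewrite -ler_pdivlMr ?ltr0n //.
  by apply: le_trans Pn; apply: fine_prob_le.
have M0 : 0 <= M by apply: le_trans (le 0%N); rewrite mulr1 ltW.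
have := le (Num.bound (M / fine (P C))); apply/negP; rewrite -ltNge.
rewrite mulrC -ltr_pdivrMr //.
apply: (lt_le_trans (archi_boundP _)); first exact: divr_ge0 M0 (ltW c0).
by rewrite ler_nat.
Qed.

End Layers.

(** * Automorphisms of the tree *)

Section TreeAutomorphisms.
Variable d : nat.
Implicit Types (i j : 'I_d) (s t u : seq 'I_d) (x y z : tree d).

Local Notation distinct := (fun i j : 'I_d => i != j).

Lemma tree_adjP x y :
  reflect (exists i, val y = i :: val x \/ val x = i :: val y) (tree_adj x y).
Proof.
apply: (iffP orP) => [[] /tree_childP[i E]|[i [E|E]]].
- by exists i; left.
- by exists i; right.
- by left; apply/tree_childP; exists i.
- by right; apply/tree_childP; exists i.
Qed.

Lemma involution_automorphism (f : tree d -> tree d) :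
  involutive f -> (forall x y, tree_child x y -> tree_adj (f x) (f y)) ->
  automorphism (@tree_adj d) f.
Proof.
move=> fK fadj; exists f; split=> // x y.
have hom (u v : tree d) : tree_adj u v -> tree_adj (f u) (f v).
  by move=> /orP[/fadj //|/fadj]; rewrite tree_adj_sym.
by apply/idP/idP => [/hom|/hom //]; rewrite !fK.
Qed.

(** Multiplication by the generator [j] in the free product, at the root end of
the word. Neighbours differ at the other end, so it preserves adjacency. *)
Fixpoint rmul_word j s : seq 'I_d :=
  if s is a :: s' then
    if s' is [::] then if a == j then [::] else [:: a; j] else a :: rmul_word j s'
  else [:: j].

Lemma path_rmul_word j a b s : path distinct a (b :: s) ->
  path distinct a (rmul_word j (b :: s)).
Proof.
elim: s a b => [|c s IHs] a b.
  by rewrite /= andbT => ab; case: eqVneq => //= bj; rewrite ab bj.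
by move=> /= /andP[ab /IHs]; rewrite ab.
Qed.

Lemma reduced_rmul_word j s : reduced s -> reduced (rmul_word j s).
Proof.
rewrite /reduced; case: s => [//|a [|b s]] /=; first by case: eqVneq => //= ->.
exact: path_rmul_word.
Qed.

Lemma rmul_wordK j s : reduced s -> rmul_word j (rmul_word j s) = s.
Proof.
rewrite /reduced; elim: s => [|a [|b s] IHs] /=.
- by rewrite eqxx.
- by move=> _; case: eqVneq => [->//|aj] /=; rewrite eqxx.
move=> /andP[ab /IHs]; rewrite -/(rmul_word j (b :: s)).
case: (rmul_word j (b :: s)) => [|c t] /= E; last by rewrite E.
by case: E ab => <- <- /negbTE ->.
Qed.

Lemma rmul_word_rcons j s : reduced (rcons s j) -> rmul_word j s = rcons s j.
Proof.
rewrite /reduced; elim: s => [//|a [|b s] IHs] /=.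
  by rewrite andbT => /negbTE ->.
by move=> /andP[_ /IHs E]; rewrite -/(rmul_word j (b :: s)) E.
Qed.

Definition rmul j x : tree d := exist (fun s => reduced s) _ (reduced_rmul_word j (valP x)).

Lemma val_rmul j x : val (rmul j x) = rmul_word j (val x).
Proof. by []. Qed.

Lemma rmul_automorphism j : automorphism (@tree_adj d) (rmul j).
Proof.
apply: involution_automorphism => [x|x y /tree_childP[i yE]].
  by apply: val_inj; rewrite !val_rmul rmul_wordK //; exact: valP x.
apply/tree_adjP; rewrite !val_rmul yE.
case: (val x) => [|b s] /=; last by exists i; left.
by case: eqVneq => [_|_]; [exists j; right|exists i; left].
Qed.

(** The automorphism is the right multiplication by the word [x], the composition of
the multiplications by its letters; the condition says that nothing cancels. *)
Lemma translation x : exists2 f, automorphism (@tree_adj d) f &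
  forall u : tree d, reduced (val u ++ val x) -> val (f u) = val u ++ val x.
Proof.
case: x => /= s; elim: s => [|i s IHs] sP.
  exists id => [|u _]; last by rewrite cats0.
  by exists id; split.
have [f fA fE] := IHs (path_sorted sP).
exists (f \o rmul i) => [|u uP]; first exact: automorphism_comp (rmul_automorphism i).
have uiP : reduced (rcons (val u) i).
  by move: uP; rewrite -cat_rcons /reduced => /cat_sorted2[].
have E : val (rmul i u) = rcons (val u) i by rewrite val_rmul rmul_word_rcons.
by rewrite [LHS]fE E cat_rcons.
Qed.

(** This applies [f] to the letters of the words that lie above [t], and moves
nothing else. *)
Definition permute_above t (f : 'I_d -> 'I_d) s : seq 'I_d :=
  if suffix t s then map f (take (size s - size t) s) ++ t else s.

Lemma permute_above_cat t f u : permute_above t f (u ++ t) = map f u ++ t.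
Proof. by rewrite /permute_above suffix_suffix size_cat addnK take_size_cat. Qed.

Lemma permute_above_id t f s : ~~ suffix t s -> permute_above t f s = s.
Proof. by rewrite /permute_above => /negbTE ->. Qed.

Variant above_spec t s : Prop :=
  | Above u of s = u ++ t | NotAbove of ~~ suffix t s.

Lemma aboveP t s : above_spec t s.
Proof.
by case: (boolP (suffix t s)) => [/suffixP[u ->]|]; [exact: Above|exact: NotAbove].
Qed.

Lemma size_permute_above t f s : size (permute_above t f s) = size s.
Proof.
case: (aboveP t s) => [u ->|/permute_above_id->//].
by rewrite permute_above_cat !size_cat size_map.
Qed.

Lemma reduced_cat_cons u h s : reduced (u ++ h :: s) = reduced (rcons u h) && path distinct h s.
Proof. by rewrite /reduced; case: u => [|a u] //=; rewrite cat_path rcons_path /= andbA. Qed.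

Section PermuteAbove.
Variables (t : seq 'I_d) (f : 'I_d -> 'I_d).
Hypothesis (fK : involutive f) (ft : forall h t', t = h :: t' -> f h = h).

Lemma reduced_permute_above s : reduced s -> reduced (permute_above t f s).
Proof.
case: (aboveP t s) => [u ->|/permute_above_id->//]; rewrite permute_above_cat.
have red_map v : reduced v -> reduced (map f v).
  rewrite /reduced sorted_map; apply: sub_sorted => i j /=.
  by rewrite (inj_eq (inv_inj fK)).
case: t ft => [_|h t' /(_ _ _ erefl) fh]; first by rewrite !cats0; exact: red_map.
rewrite !reduced_cat_cons => /andP[/red_map + ->].
by rewrite map_rcons fh andbT.
Qed.

Lemma permute_aboveK : involutive (permute_above t f).
Proof.
move=> s; case: (aboveP t s) => [u ->|ns]; last by rewrite !permute_above_id // permute_above_id.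
by rewrite !permute_above_cat -map_comp map_id_in // => i _ /=.
Qed.

Definition permute_tree x : tree d := exist (fun s => reduced s) _ (reduced_permute_above (valP x)).

Lemma val_permute_tree x : val (permute_tree x) = permute_above t f (val x).
Proof. by []. Qed.

Lemma permute_tree_automorphism : automorphism (@tree_adj d) permute_tree.
Proof.
apply: involution_automorphism => [x|x y /tree_childP[i yE]].
  by apply: val_inj; rewrite !val_permute_tree permute_aboveK.
apply/tree_adjP; rewrite !val_permute_tree yE.
case: (aboveP t (val x)) => [u ->|nx].
  by rewrite -cat_cons !permute_above_cat; exists (f i); left.
rewrite (permute_above_id _ nx).
case: (aboveP t (i :: val x)) => [[|j u] E|ny].
- by rewrite E permute_above_cat /=; have /= <- := E; exists i; left.
- by move: nx; have [_ E'] := E; rewrite [val x]E' suffix_suffix.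
- by rewrite permute_above_id //; exists i; left.
Qed.

End PermuteAbove.

(** Letters are matched one at a time from the root; at each step a transposition
of the branches above the part that already agrees corrects the next letter. *)
Lemma sphere_transitive x y : size (val x) = size (val y) ->
  exists f, [/\ automorphism (@tree_adj d) f, f x = y &
    forall z, size (val (f z)) = size (val z)].
Proof.
case: x y => s sP [t tP] /=; elim: s t sP tP => [|i s IHs] [|j t] //= sP tP.
  move=> _; exists id; split=> //; first by exists id.
  exact: val_inj.
move=> [st]; have sP' := path_sorted sP; have tP' := path_sorted tP.
have [f [fA fst fsz]] := IHs t sP' tP' st.
pose x : tree d := exist _ (i :: s) sP.
have [k fxE] : exists k, val (f x) = k :: t.
  have [g [_ _ fadj]] := fA.
  have : tree_adj (f (exist _ s sP')) (f x).
    by rewrite fadj; apply/tree_adjP; exists i; left.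
  rewrite fst => /tree_adjP[k [E|E]]; first by exists k.
  by have := congr1 size E; rewrite /= fsz /= -st; lia.
have kP : reduced (k :: t) by rewrite -fxE; exact: valP.
have fixt h t' : t = h :: t' -> tperm k j h = h.
  by move=> tE; move: kP tP; rewrite /reduced tE /= => /andP[kh _] /andP[jh _]; rewrite tpermD.
have gA := permute_tree_automorphism (tpermK k j) fixt.
exists (permute_tree (tpermK k j) fixt \o f); split.
- exact: automorphism_comp.
- by apply: val_inj; rewrite val_permute_tree fxE -cat1s permute_above_cat /= tpermL.
- by move=> z; rewrite val_permute_tree size_permute_above fsz.
Qed.

End TreeAutomorphisms.

(** * Spheres of the tree *)

Section SphereCount.
Variable d : nat.

Fixpoint sphere_words (n : nat) : seq (seq 'I_d) :=
  if n is n'.+1 then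
    [seq i :: s | s <- sphere_words n',
       i <- [seq i <- enum 'I_d | if s is j :: _ then i != j else true]]
  else [:: [::]].

Lemma sphere_wordsS n : sphere_words n.+1 = [seq i :: s | s <- sphere_words n,
  i <- [seq i <- enum 'I_d | if s is j :: _ then i != j else true]].
Proof. by []. Qed.

Lemma mem_sphere_words (s : seq 'I_d) : reduced s -> s \in sphere_words (size s).
Proof.
rewrite /reduced; elim: s => [//|i s IHs] sP.
rewrite sphere_wordsS; apply/allpairsPdep; exists s, i; split=> //.
  exact/IHs/(path_sorted sP).
by rewrite mem_filter mem_enum andbT; case: (s) sP => //= j s' /andP[].
Qed.

(** A letter that extends a nonempty word must differ from its first letter. *)
Lemma size_sphere_words n : (size (sphere_words n.+1) <= d * d.-1 ^ n)%N.
Proof.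
elim: n => [|n IHn].
  rewrite sphere_wordsS size_allpairs_dep /= addn0 muln1 size_filter.
  by apply: leq_trans (count_size _ _) _; rewrite size_enum_ord.
rewrite sphere_wordsS size_allpairs_dep expnSr mulnA.
apply: leq_trans (leq_mul IHn (leqnn _)).
have : all (fun s => s != [::]) (sphere_words n.+1).
  by apply/allP => u; rewrite sphere_wordsS => /allpairsPdep[s [i [_ _ ->]]].
elim: (sphere_words n.+1) => //= s l IHl /andP[s0 /IHl le].
rewrite mulSn leq_add //; case: s s0 => // j s _.
have E : (1 + count (predC (pred1 j)) (enum 'I_d) = d)%N.
  by rewrite -[RHS]size_enum_ord -(count_predC (pred1 j)) count_uniq_mem ?enum_uniq // mem_enum.
by rewrite size_filter -ltnS (leq_trans _ (leqSpred d)) // -[X in (_ <= X)%N]E.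
Qed.

End SphereCount.

Section SphereSum.
Variables (d : nat) (R : realType) (b : R).
Hypotheses (b0 : 0 <= b) (db1 : d.-1%:R * b < 1).

Lemma size_sphere (s : seq (tree d)) n : uniq s ->
  (forall x, x \in s -> size (val x) = n) -> (size s <= size (@sphere_words d n))%N.
Proof.
move=> us sn; rewrite -(size_map val); apply: uniq_leq_size.
  by rewrite (map_inj_uniq val_inj).
move=> _ /mapP[x xs ->]; rewrite -(sn _ xs); apply: mem_sphere_words; exact: valP x.
Qed.

Lemma sum_ball_le (L : nat) (s : seq (tree d)) : uniq s ->
  (forall x, x \in s -> (size (val x) < L)%N) ->
  \sum_(x <- s) b ^+ size (val x) <= \sum_(n < L) (size (@sphere_words d n))%:R * b ^+ n.
Proof.
elim: L s => [|L IHL] s us sL.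
  case: s us sL => [|x s] _ sL; first by rewrite big_nil big_ord0.
  by have := sL x (mem_head _ _).
rewrite big_ord_recr /= (bigID (fun x => size (val x) < L)%N) /=.
rewrite -[X in X + _]big_filter -[X in _ + X]big_filter.
apply: lerD.
  apply: IHL => [|x]; first exact: filter_uniq.
  by rewrite mem_filter => /andP[].
set t := [seq _ <- _ | _].
have tL x : x \in t -> size (val x) = L.
  by rewrite mem_filter -leqNgt => /andP[Lx /sL xL]; apply/eqP; rewrite eqn_leq Lx andbT -ltnS.
rewrite (eq_big_seq (fun=> b ^+ L)) => [|x /tL -> //].
rewrite big_const_seq count_predT iter_addr_0 -[leLHS]mulr_natl.
rewrite ler_wpM2r ?exprn_ge0 // ler_nat; apply: size_sphere => //.
exact: filter_uniq.
Qed.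

Lemma geometric_sum_le (q : R) (L : nat) : 0 <= q -> q < 1 -> \sum_(n < L) q ^+ n <= (1 - q)^-1.
Proof.
move=> q0 q1; have q1' : 0 < 1 - q by rewrite subr_gt0.
rewrite -[leRHS]mul1r ler_pdivlMr // mulrC -opprB mulNr -subrX1 opprB.
by rewrite gerBl exprn_ge0.
Qed.

(** The sphere of radius [n + 1] contributes at most [d * b * ((d - 1) * b) ^ n]. *)
Lemma sum_tree_le (s : seq (tree d)) : uniq s ->
  \sum_(x <- s) b ^+ size (val x) <= 1 + d%:R * b / (1 - d.-1%:R * b).
Proof.
move=> us; set q := d.-1%:R * b.
have q0 : 0 <= q by rewrite mulr_ge0.
pose L := (\max_(x <- s) (size (val x)))%N.
apply: le_trans (sum_ball_le (L := L.+1) us _) _.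
  by move=> x xs; rewrite ltnS; exact: (leq_bigmax_seq (F := fun x => size (val x))).
rewrite big_ord_recl /= mul1r expr0 lerD2l.
apply: le_trans (_ : \sum_(n < L) d%:R * b * q ^+ n <= _).
  apply: ler_sum => n _; rewrite /bump /= add1n.
  have : ((size (@sphere_words d n.+1))%:R : R) <= d%:R * d.-1%:R ^+ n.
    by rewrite -natrX -natrM ler_nat size_sphere_words.
  move=> /(ler_wpM2r (exprn_ge0 n.+1 b0)) /le_trans; apply.
  by rewrite /q exprMn exprS -!mulrA ler_wpM2l // [d.-1%:R ^+ n * _]mulrCA.
rewrite -mulr_sumr ler_wpM2l ?mulr_ge0 //.
exact: geometric_sum_le.
Qed.

End SphereSum.

(** * The product of the tree with the line *)

Section Product.
Variable d : nat.
Local Notation TZ := (TZ d).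
Local Notation adj := (@TZ_adj d).
Local Notation o := (TZ_origin d).
Implicit Types (x y z : tree d) (k l : int) (u : TZ).

Lemma line_adjP k l : reflect (l = k + 1 \/ k = l + 1) (line_adj k l).
Proof.
rewrite /line_adj; apply: (iffP eqP); last by lia.
by lia.
Qed.

Lemma TZ_adj_sym : symmetric adj.
Proof.
move=> u v; rewrite /TZ_adj /box_adj tree_adj_sym eq_sym [u.1 == _]eq_sym; congr (_ || (_ && _)).
by apply/line_adjP/line_adjP; case; auto.
Qed.

Lemma product_automorphism (f : tree d -> tree d) (g : int -> int) :
  automorphism (@tree_adj d) f -> automorphism line_adj g ->
  automorphism adj (fun u => (f u.1, g u.2)).
Proof.
move=> [f' [fK f'K fadj]] [g' [gK g'K gadj]].
exists (fun u => (f' u.1, g' u.2)); split=> [[x k]|[x k]|u v] /=.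
- by rewrite fK gK.
- by rewrite f'K g'K.
- by rewrite /TZ_adj /box_adj /= fadj gadj (inj_eq (can_inj fK)) (inj_eq (can_inj gK)).
Qed.

Lemma id_automorphism (V : countType) (adjV : rel V) : automorphism adjV id.
Proof. by exists id. Qed.

Lemma shift_automorphism (c : int) : automorphism line_adj (fun k => k + c).
Proof.
exists (fun k => k - c); split=> [k|k|k l]; [lia|lia|].
by apply/line_adjP/line_adjP; lia.
Qed.

Lemma reflection_automorphism : automorphism line_adj (fun k => - k).
Proof.
exists (fun k => - k); split=> [k|k|k l]; [lia|lia|].
by apply/line_adjP/line_adjP; lia.
Qed.

Lemma TZ_adj_height u v : adj u v ->
  [\/ v.2 = u.2, v = (u.1, u.2 + 1) | v = (u.1, u.2 - 1)].
Proof.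
case: u v => x k [y l] /orP[/andP[_ /eqP kl]|/andP[/eqP /= <- /line_adjP[] kl]].
- by constructor 1.
- by constructor 2; rewrite kl.
- by constructor 3; rewrite kl; congr pair; lia.
Qed.

Lemma TZ_adj_up x k : adj (x, k) (x, k + 1).
Proof. by apply/orP; right; rewrite /= eqxx; apply/line_adjP; left. Qed.

Lemma TZ_adj_down x k : adj (x, k) (x, k - 1).
Proof. by rewrite TZ_adj_sym -{2}(subrK 1 k) TZ_adj_up. Qed.

Section TreeDistance.
Variables (R : realType) (p : R) (P : probability (config adj) R).
Hypothesis (p01 : 0 <= p <= 1) (hP : is_bernoulli_percolation p P).
Local Notation conn := (conn P).

Lemma conn_sphere x y k : size (val x) = size (val y) -> conn o (x, k) = conn o (y, k).
Proof.
move=> /sphere_transitive[f [fA <- fsz]].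
have fo : f (tree_root d) = tree_root d by apply: val_inj; apply: size0nil; rewrite fsz.
by rewrite -(conn_automorphism hP TZ_adj_sym o (x, k)
  (product_automorphism fA (id_automorphism _))) /= fo.
Qed.

Lemma conn_reflect x k : conn o (x, - k) = conn o (x, k).
Proof.
by rewrite -(conn_automorphism hP TZ_adj_sym o (x, k)
  (product_automorphism (id_automorphism _) reflection_automorphism)) /= oppr0.
Qed.

(** The translation by [x] takes the root to [x] and [y] to [z]. *)
Lemma conn_translate x y z k l : val z = val y ++ val x ->
  conn (x, k) (z, l) = conn o (y, l - k).
Proof.
move=> zE; have [f fA fE] := translation x.
have fr : f (tree_root d) = x by apply: val_inj; rewrite fE //; exact: valP x.
have fy : f y = z by apply: val_inj; rewrite fE -zE //; exact: valP z.
rewrite -(conn_automorphism hP TZ_adj_sym o (y, l - k)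
  (product_automorphism fA (shift_automorphism k))) /=.
by rewrite fr fy add0r subrK.
Qed.

(** This cuts the geodesic from the root to [z] at distance [n] from the root; the
upper part is read as a vertex, in view of [conn_translate]. *)
Lemma split_word z m n : size (val z) = (m + n)%N ->
  exists x y, [/\ val z = val y ++ val x, size (val y) = m & size (val x) = n].
Proof.
move=> zE; have : reduced (take m (val z) ++ drop m (val z)).
  by rewrite cat_take_drop; exact: valP z.
move=> /cat_sorted2[rt rd].
exists (exist (fun s => reduced s) _ rd), (exist (fun s => reduced s) _ rt); split=> /=.
- by rewrite cat_take_drop.
- by rewrite size_takel // zE leq_addr.
- by rewrite size_drop zE addKn.
Qed.

Variable v : nat -> tree d.
Hypothesis size_v : forall n, size (val (v n)) = n.
Local Notation T n := (conn o (v n, 0)).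

Lemma tree_conn_supermul m n : T m * T n <= T (m + n)%N.
Proof.
have [x [y [zE ym xn]]] := split_word (size_v (m + n)).
apply: le_trans (conn_supermul p01 hP o (x, 0) (v (m + n)%N, 0)).
rewrite mulrC (conn_translate _ _ zE) subrr.
by rewrite (conn_sphere 0 (_ : size (val x) = size (val (v n)))) ?size_v //
  (conn_sphere 0 (_ : size (val y) = size (val (v m)))) ?size_v.
Qed.

Lemma tree_conn_gt0 n : 0 < p -> 0 < T n <= 1.
Proof.
move=> p0; rewrite conn_le1 andbT; elim: n => [|n IHn].
  rewrite (_ : (v 0%N, 0) = o) ?conn_refl ?ltr01 //.
  by congr pair; apply: val_inj; apply: size0nil.
have := tree_conn_supermul 1 n; rewrite add1n; apply: lt_le_trans.
rewrite mulr_gt0 //; apply: lt_le_trans p0 _.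
apply: conn_adj hP TZ_adj_sym _ _ _ _ => //.
  have := size_v 1; case E : (val (v 1%N)) => [|i [|j s]] // _.
  by apply/orP; left; rewrite /= eqxx andbT; apply/tree_adjP; exists i; left; rewrite E.
by apply/eqP => -[] /(congr1 (fun x => size (val x))); rewrite size_v.
Qed.

(** Going up to height [k] and back down costs the square of the connection
probability, so heights do not help: the bound at height [0] holds everywhere. *)
Lemma conn_sqr_le x k : conn o (x, k) ^+ 2 <= T (size (val x) + size (val x))%N.
Proof.
set n := size (val x).
have [x' [y [zE yn xn]]] := split_word (size_v (n + n)).
apply: le_trans (conn_supermul p01 hP o (x', k) (v (n + n)%N, 0)).
rewrite (conn_translate _ _ zE) sub0r conn_reflect expr2.
by rewrite (conn_sphere k (_ : size (val x') = size (val x))) //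
  (conn_sphere k (_ : size (val y) = size (val x))).
Qed.

End TreeDistance.
End Product.

(** * Absence of infinite clusters, and the bound on alpha *)

Section Subcritical.
Variable d : nat.
Local Notation TZ := (TZ d).
Local Notation adj := (@TZ_adj d).
Local Notation o := (TZ_origin d).
Variables (R : realType) (p : R) (P : probability (config adj) R) (b : R).
Hypotheses (p01 : 0 <= p <= 1) (p1 : p < 1) (hP : is_bernoulli_percolation p P).
Hypotheses (b0 : 0 <= b) (db1 : d.-1%:R * b < 1).
Hypothesis conn_le : forall (x : tree d) (k : int), conn P o (x, k) <= b ^+ size (val x).

Lemma sum_layer_le (k : int) (s : seq TZ) : uniq s -> (forall u, u \in s -> u.2 = k) ->
  \sum_(u <- s) conn P o u <= 1 + d%:R * b / (1 - d.-1%:R * b).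
Proof.
move=> us sk.
have us1 : uniq (map fst s).
  rewrite map_inj_in_uniq // => -[x l] [y m] /sk /= -> /sk /= ->.
  by move=> ->.
apply: le_trans (sum_tree_le b0 db1 us1); rewrite big_map.
by apply: ler_sum => -[x l] _; exact: conn_le.
Qed.

(** If the cluster misses some layer above the origin and some layer below it, then it
lies between them. So when it is infinite, it has infinitely many points in one of
finitely many layers. *)
Lemma infinite_cluster_origin_null : P.-negligible [set w | infinite_set (Defs.cluster w o)].
Proof.
pose down (u : TZ) : TZ := (u.1, u.2 - 1).
pose up (u : TZ) : TZ := (u.1, u.2 + 1).
pose neg_ht (u : TZ) : int := - u.2.
pose pos_ht (u : TZ) : int := u.2.
have up_adj u v : adj u v -> pos_ht v <= pos_ht u \/ v = up u.
  by rewrite /pos_ht => /TZ_adj_height[->|->|->]; [left|right|left => /=; lia].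
have down_adj u v : adj u v -> neg_ht v <= neg_ht u \/ v = down u.
  by rewrite /neg_ht => /TZ_adj_height[->|->|->]; [left|left => /=; lia|right].
have adj_up u : adj u (up u) by case: u => x k; exact: TZ_adj_up.
have adj_down u : adj u (down u) by case: u => x k; exact: TZ_adj_down.
have ht_up u : pos_ht (up u) = pos_ht u + 1 by [].
have ht_down u : neg_ht (down u) = neg_ht u + 1 by rewrite /neg_ht /=; lia.
have sum_up := sum_layer_le.
have sum_down k (s : seq TZ) : uniq s -> (forall u, u \in s -> neg_ht u = k) ->
    \sum_(u <- s) conn P o u <= 1 + d%:R * b / (1 - d.-1%:R * b).
  move=> us sk; apply: (sum_layer_le (k := - k)) => // u /sk <-.
  by rewrite /neg_ht opprK.
have crowd0 := negligible_exists (crowded_all_null (ht := pos_ht) sum_up).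
have up0 := hits_all_null (@TZ_adj_sym d) adj_up ht_up up_adj p01 hP sum_up p1.
have down0 := hits_all_null (@TZ_adj_sym d) adj_down ht_down down_adj p01 hP sum_down p1.
have m_all (ht : TZ -> int) :
    measurable [set w : config adj | forall i : nat, hits ht o (ht o + i%:Z) w].
  by apply: measurable_forall => i; exact: measurable_hits.
have up_null := (negligibleP P (m_all pos_ht)).2 up0.
have down_null := (negligibleP P (m_all neg_ht)).2 down0.
apply: negligibleS (negligibleU crowd0 (negligibleU up_null down_null)) => w /= inf.
have [|nup] := pselect (forall i : nat, hits pos_ht o (pos_ht o + i%:Z) w).
  by right; left.
have [|ndown] := pselect (forall i : nat, hits neg_ht o (neg_ht o + i%:Z) w).
  by right; right.
have /existsNP[i ni] := nup; have /existsNP[j nj] := ndown.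
(* the cluster is confined to heights between [- j] and [i] *)
left; apply: contrapT => ncr; apply: inf.
pose layer (k : int) : set TZ := [set u | u.2 = k /\ joined w o u].
have layer_fin k : finite_set (layer k).
  apply: contrapT => linf; apply: ncr; exists k => n.
  have [B Bk nB] := infinite_set_fset n.+1 linf.
  exists (take n.+1 (enum_fset B)); split; rewrite ?take_uniq ?fset_uniq ?size_takel //.
  by move=> u /mem_take /Bk.
apply: (sub_finite_set (B := \bigcup_(n in `I_(i + j)) layer (n%:Z - j%:Z))); last first.
  by apply: bigcup_finite => //; exact: finite_II.
move=> u ou.
have ui := not_hits_bounded (@TZ_adj_sym d) ht_up up_adj ni ou.
have uj := not_hits_bounded (@TZ_adj_sym d) ht_down down_adj nj ou.
case: u ou ui uj => x k ou; rewrite /pos_ht /neg_ht /= => ki kj.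
exists (absz (k + j%:Z)) => /=; first by lia.
by split=> //=; lia.
Qed.

Lemma no_infinite_cluster : P.-negligible [set w | exists C, @infinite_cluster _ adj w C].
Proof.
have nx (x : TZ) : P.-negligible [set w | infinite_set (Defs.cluster w x)].
  have [f fA fE] := translation x.1.
  have fr : f (tree_root d) = x.1 by apply: val_inj; rewrite fE //; exact: valP x.1.
  have xE : x = (fun u : TZ => (f u.1, u.2 + x.2)) o by rewrite /= fr add0r; case: (x).
  have m0 := measurable_infinite_cluster (adj := adj).
  apply/negligibleP; first exact: m0.
  have := infinite_cluster_automorphism hP (@TZ_adj_sym d) o
    (product_automorphism fA (shift_automorphism x.2)).
  rewrite -xE => E; apply: etrans E _; apply/negligibleP; first exact: m0.
  exact: infinite_cluster_origin_null.
apply: negligibleS (negligible_exists nx) => w /= [_ [[x ->] inf]].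
by exists x.
Qed.

End Subcritical.

(** At [p = 1] every edge is open and the vertical line through the origin is
already infinite. *)
Lemma infinite_cluster_full (d : nat) (R : realType) (P : probability (config (@TZ_adj d)) R) :
  is_bernoulli_percolation 1 P -> {ae P, forall w, exists C, infinite_cluster w C}.
Proof.
move=> hP.
have closed0 (e : edge (@TZ_adj d)) : P.-negligible [set w : config _ | w e = false].
  apply/negligibleP; first exact: measurable_state.
  have := hP [:: e] (fun=> false) isT; rewrite big_seq1 /= subrr => E; apply: etrans E; congr (P _).
  apply/seteqP; split=> w /= => [we e'|]; first by rewrite inE => /eqP ->.
  by apply; rewrite mem_head.
apply: negligibleS (negligible_exists closed0) => w /= ninf.
apply: contrapT => nclosed; apply: ninf.
have all_open e : w e by apply: contrapT => /negP/negbTE we; apply: nclosed; exists e.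
exists (Defs.cluster w (TZ_origin d)); split; first by exists (TZ_origin d).
pose line (n : nat) : TZ d := (tree_root d, n%:Z).
have line_joined n : joined w (TZ_origin d) (line n).
  elim: n => [|n IHn]; first exact: joined_refl.
  apply: joined_trans IHn _; apply: joined_open.
  have adj_n : TZ_adj (line n) (line n.+1).
    by rewrite /line -addn1 PoszD; exact: TZ_adj_up.
  have ne : line n != line n.+1 by apply/eqP => -[]; lia.
  have [e eE] := edge_between (@TZ_adj_sym d) adj_n ne.
  by exists e.
apply: (sub_infinite_set (A := range line)) => [_ [n _ <-]|]; first exact: line_joined.
have line_inj : injective line by move=> m n [].
by move=> /(finite_preimage (in2W line_inj)); rewrite preimage_range; exact: infinite_nat.
Qed.

Theorem lemma1p5 (R : realType) (d : nat) (hd : (3 <= d)%N)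
    (P : R -> probability (config (@TZ_adj d)) R) (hP : percolation_family P)
    (v : nat -> tree d)
    (hv : forall n, at_distance (@tree_adj d) (tree_root d) (v n) n)
    (p : R) (hp : p_c P < p < p_u P) :
  (d%:R - 1)^-1 <= alpha P v p.
Proof.
have size_v n : size (val (v n)) = n by apply/tree_root_distance; exact: hv.
have /andP[pc_p p_pu] := hp.
(* the infimum of the empty set is 0, and would give no [q] below [p] *)
have pc_set : [set p | 0 <= p <= 1 /\
    {ae P p, forall w, exists C, infinite_cluster w C}] !=set0.
  by exists 1; split; [|apply: infinite_cluster_full; apply: hP]; rewrite ler01 lexx.
have [q [/andP[q0 q1] q_inf] qp] := inf_lt pc_set pc_p.
have p0 : 0 < p := le_lt_trans q0 qp.
have p1 : p < 1.
  apply: lt_le_trans p_pu _; rewrite /p_u; set U := [set _ | _].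
  have [->|/set0P[r Ur]] := eqVneq U set0; first by rewrite inf0 ler01.
  have r1 : r <= 1 by case: Ur => /andP[].
  apply: le_trans r1; apply: ge_inf Ur.
  by exists 0 => z [/andP[]].
have p01 : 0 <= p <= 1 by rewrite !ltW.
rewrite leNgt; apply/negP => small.
pose a := alpha P v p; pose o := TZ_origin d.
have T0 : conn (P p) o (v 0%N, 0) = 1.
  have -> : v 0%N = tree_root d by apply: val_inj; exact: size0nil.
  exact: conn_refl.
have Ta : forall m, conn (P p) o (v m, 0) <= a ^+ m.
  apply: supermultiplicative_le_lim T0 _ _ => [n|m n].
    exact: (tree_conn_gt0 p01 (hP _ p01)).
  exact: (tree_conn_supermul p01 (hP _ p01)).
have a0 : 0 <= a by apply: le_trans (Ta 1%N); exact: conn_ge0.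
(* by squaring, this reduces to height 0 and distance [2 * size (val x)] *)
have conn_p x k : conn (P p) o (x, k) <= a ^+ size (val x).
  rewrite -(@ler_pXn2r _ 2) ?nnegrE ?exprn_ge0 ?conn_ge0 //.
  apply: le_trans (conn_sqr_le p01 (hP _ p01) size_v x k) _.
  by rewrite -exprM muln2 -addnn Ta.
have q01 : 0 <= q <= 1 by rewrite q0 q1.
have conn_q x k : conn (P q) o (x, k) <= a ^+ size (val x).
  apply: le_trans (conn_p x k).
  apply: (prob_le_param q0 (ltW qp) (ltW p1) (hP _ q01) (hP _ p01)).
    exact: joined_increasing.
  exact: joined_finitary.
have da1 : d.-1%:R * a < 1.
  have d1 : d%:R - 1 = d.-1%:R :> R by rewrite -[d in LHS](ltn_predK hd) -natr1 addrK.
  rewrite -d1 mulrC -ltr_pdivlMr ?d1 ?ltr0n; last by lia.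
  by rewrite div1r -d1.
have none := no_infinite_cluster q01 (lt_trans qp p1) (hP _ q01) a0 da1 conn_q.
have /(negligibleP _ measurableT) : (P q).-negligible setT.
  apply: negligibleS (negligibleU q_inf none) => w _ /=.
  by have [|] := pselect (exists C, infinite_cluster w C); [right|left].
by move=> E; have := probability_setT (P q); rewrite [LHS]E => /eqP; rewrite eqe eq_sym oner_eq0.
Qed.
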